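(* Let $R>0$ and let $\Sigma_R\subset H^1$ be the CMC sphere with mean curvature $H=1/(\varepsilon R)>0$. Then the vector field $\nabla_{\mathcal M}\mathcal M$ is smoothly defined on $\Sigma_R$ (that is, it extends smoothly to the poles) and for any $(z,t)\in\Sigma_R$ we have $$\nabla_{\mathcal M}\mathcal M(z,t)=-\frac{H}{\omega(|z|)^2}\,\mathcal N(z,t).$$ In particular, $\nabla^{\Sigma_R}_{\mathcal M}\mathcal M=0$, and the integral curves of $\mathcal M$ are Riemannian geodesics of $\Sigma_R$ joining the north pole $N$ to the south pole $S$.
   Context: Fix real numbers $\varepsilon>0$, $\tau\neq 0$ and set $\sigma=\tau\varepsilon^4$. $H^1$ denotes the Heisenberg group $\mathbb C\times\mathbb R\ni(z,t)$, $z=x+iy$, with group law $(z,t)\cdot(z',t')=(z+z',t+t'+\sigma(yx'-xy'))$, and left-invariant vector fields $$X=\frac1\varepsilon\Big(\frac{\partial}{\partial x}+\sigma y\frac{\partial}{\partial t}\Big),\quad Y=\frac1\varepsilon\Big(\frac{\partial}{\partial y}-\sigma x\frac{\partial}{\partial t}\Big),\quad T=\varepsilon^2\frac{\partial}{\partial t},$$ so that $[X,Y]=-2\tau T$ and $[X,T]=[Y,T]=0$. $H^1$ carries the left-invariant Riemannian metric $g=\langle\cdot,\cdot\rangle$ making $X,Y,T$ orthonormal; $\nabla$ is its Levi-Civita connection. Let $\omega(r)=\sqrt{1+\tau^2\varepsilon^2r^2}$. For $R>0$ and $0\le r\le R$ let $$f(r;R)=\frac{\varepsilon^2}{2\tau}\Big[\omega(R)^2\arctan\Big(\tau\varepsilon\frac{\sqrt{R^2-r^2}}{\omega(r)}\Big)+\tau\varepsilon\,\omega(r)\sqrt{R^2-r^2}\Big],$$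 and $\Sigma_R=\{(z,t)\in H^1: |z|\le R,\ |t|=f(|z|;R)\}$, a compact smooth embedded sphere with constant mean curvature $H=1/(\varepsilon R)$ (mean curvature is one half of the trace of the shape operator $W\mapsto\nabla_W\mathcal N$). Its poles are $N=(0,f(0;R))$ and $S=-N$, and $\Sigma_R^*=\Sigma_R\setminus\{N,S\}$. The spheres $\Sigma_R$, $R>0$, foliate $H^1_*=H^1\setminus\{0\}$, and $\mathcal N$ is the unit vector field on $H^1_*$ whose restriction to each $\Sigma_R$ is the exterior unit normal. The vector field $\nabla_{\mathcal N}\mathcal N$ on $H^1_*$ is tangent to every $\Sigma_R$ and vanishes exactly where $z=0$ or $t=0$. The vector field $$\mathcal M(z,t)=\mathrm{sgn}(t)\,\frac{\nabla_{\mathcal N}\mathcal N}{|\nabla_{\mathcal N}\mathcal N|}$$ is defined by this formula on $\Sigma_R^*\setminus\{t=0\}$, and by its smooth extension across the equator $\{t=0\}$ on the whole of $\Sigma_R^*$. $\nabla^{\Sigma_R}$ denotes the restriction of $\nabla$ to $\Sigma_R$ (the tangential part of $\nabla$, i.e. the Levi-Civita connection of the induced metric on $\Sigma_R$). *)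

(* Defs.v *)
From Stdlib Require Import Reals Lra.
From Coquelicot Require Import Coquelicot.
Open Scope R_scope.

(* Points (x, y, t) of H^1 = C x R.  A tangent vector is the triple of its
   components in the coordinate frame (d/dx, d/dy, d/dt); a vector field is a
   total map [pt -> pt], looked at only where the mathematical field lives. *)
Notation pt := (R * R * R)%type.

Definition cx (p : pt) : R := fst (fst p).
Definition cy (p : pt) : R := snd (fst p).
Definition ct (p : pt) : R := snd p.

(* |z| *)
Definition normz (p : pt) : R := sqrt (cx p ^ 2 + cy p ^ 2).

Definition along (F : pt -> R) (p v : pt) (h : R) : R := F (plus p (scal h v)).

Definition deriv_along (F : pt -> R) (p v : pt) : R := Derive (along F p v) 0.

Definition field_deriv (W : pt -> pt) (p v : pt) : pt :=
  (deriv_along (fun q => cx (W q)) p v,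
   deriv_along (fun q => cy (W q)) p v,
   deriv_along (fun q => ct (W q)) p v).

(* C^k on an open set U: all directional derivatives exist and are C^(k-1). *)
Fixpoint Ck (k : nat) (U : pt -> Prop) (F : pt -> R) : Prop :=
  (forall p, U p -> continuous F p) /\
  match k with
  | O => True
  | S k' => forall v : pt,
      (forall p, U p -> ex_derive (along F p v) 0) /\
      Ck k' U (fun p => deriv_along F p v)
  end.

Definition smooth (U : pt -> Prop) (F : pt -> R) : Prop := forall k, Ck k U F.

Definition smooth_field (U : pt -> Prop) (V : pt -> pt) : Prop :=
  smooth U (fun p => cx (V p)) /\
  smooth U (fun p => cy (V p)) /\
  smooth U (fun p => ct (V p)).

(* Smoothness along a subset S which need not be open (here a submanifold):
   locally, V is the restriction to S of a smooth field on an open set. *)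
Definition smooth_field_on (S : pt -> Prop) (V : pt -> pt) : Prop :=
  forall p, S p -> exists (U : pt -> Prop) (F : pt -> pt),
    open U /\ U p /\ smooth_field U F /\
    (forall q, S q -> U q -> F q = V q).

(* Velocities at p of the curves in S. *)
Definition tangent_vector (S : pt -> Prop) (p v : pt) : Prop :=
  exists c : R -> pt,
    c 0 = p /\ locally 0 (fun u => S (c u)) /\ is_derive c 0 v.

Definition in_interval (a b : Rbar) (u : R) : Prop := Rbar_lt a u /\ Rbar_lt u b.

Definition integral_curve
  (S : pt -> Prop) (V : pt -> pt) (a b : Rbar) (c : R -> pt) : Prop :=
  Rbar_lt a b /\
  forall u, in_interval a b u -> S (c u) /\ is_derive c u (V (c u)).

Definition maximal_integral_curve
  (S : pt -> Prop) (V : pt -> pt) (a b : Rbar) (c : R -> pt) : Prop :=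
  integral_curve S V a b c /\
  forall (a' b' : Rbar) (c' : R -> pt),
    integral_curve S V a' b' c' -> Rbar_le a' a -> Rbar_le b b' ->
    (forall u, in_interval a b u -> c' u = c u) ->
    a' = a /\ b' = b.

Section Heisenberg.

Variables eps tau : R.

Definition sigma : R := tau * eps ^ 4.

Definition X (p : pt) : pt := (/ eps, 0, / eps * (sigma * cy p)).
Definition Y (p : pt) : pt := (0, / eps, - (/ eps * (sigma * cx p))).
Definition T (p : pt) : pt := (0, 0, eps ^ 2).

(* The components of v in the frame (X, Y, T) at p are
   eps * cx v, eps * cy v and theta p v / eps ^ 2. *)
Definition theta (p v : pt) : R := ct v - sigma * (cy p * cx v - cx p * cy v).

Definition g (p u v : pt) : R :=
  eps ^ 2 * (cx u * cx v + cy u * cy v) + theta p u * theta p v / eps ^ 4.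

(* Christoffel map of g in the coordinates (x, y, t): for constant vectors
   u, v, w (which commute as vector fields), the Koszul formula reads
   2 g(Gamma(u, v), w) = u.g(v, w) + v.g(u, w) - w.g(u, v). *)
Definition koszul (p u v w : pt) : R :=
  (deriv_along (fun q => g q v w) p u
   + deriv_along (fun q => g q u w) p v
   - deriv_along (fun q => g q u v) p w) / 2.

Definition christoffel (p u v : pt) : pt :=
  plus (plus (scal (koszul p u v (X p)) (X p))
             (scal (koszul p u v (Y p)) (Y p)))
       (scal (koszul p u v (T p)) (T p)).

(* Levi-Civita connection *)
Definition nabla (V W : pt -> pt) (p : pt) : pt :=
  plus (field_deriv W p (V p)) (christoffel p (V p) (W p)).

Definition omega (r : R) : R := sqrt (1 + tau ^ 2 * eps ^ 2 * r ^ 2).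

Definition profile (r Rad : R) : R :=
  eps ^ 2 / (2 * tau) *
  (omega Rad ^ 2 * atan (tau * eps * (sqrt (Rad ^ 2 - r ^ 2) / omega r))
   + tau * eps * omega r * sqrt (Rad ^ 2 - r ^ 2)).

Definition sphere (Rad : R) (p : pt) : Prop :=
  normz p <= Rad /\ Rabs (ct p) = profile (normz p) Rad.

(* the closed region bounded by the sphere *)
Definition ball_region (Rad : R) (p : pt) : Prop :=
  normz p <= Rad /\ Rabs (ct p) <= profile (normz p) Rad.

Definition north (Rad : R) : pt := (0, 0, profile 0 Rad).
Definition south (Rad : R) : pt := (0, 0, - profile 0 Rad).

Definition sphere_star (Rad : R) (p : pt) : Prop :=
  sphere Rad p /\ p <> north Rad /\ p <> south Rad.

Definition exterior_unit_normal (Rad : R) (p n : pt) : Prop :=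
  g p n n = 1 /\
  (forall v, tangent_vector (sphere Rad) p v -> g p n v = 0) /\
  at_right 0 (fun h => ~ ball_region Rad (plus p (scal h n))).

Definition is_normal_field (NN : pt -> pt) : Prop :=
  forall Rad, 0 < Rad -> forall p, sphere Rad p ->
    exterior_unit_normal Rad p (NN p).

Definition is_meridian_field (NN MM : pt -> pt) : Prop :=
  forall Rad, 0 < Rad ->
    (forall p, sphere_star Rad p -> ct p <> 0 ->
       let a := nabla NN NN p in
       MM p = scal (sign (ct p)) (scal (/ sqrt (g p a a)) a)) /\
    smooth_field_on (sphere_star Rad) MM.

(* Component tangent to the leaf through p. *)
Definition tangential (NN : pt -> pt) (p v : pt) : pt :=
  minus v (scal (g p v (NN p)) (NN p)).

(* The Levi-Civita connection of the leaves *)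
Definition nabla_leaf (NN V W : pt -> pt) (p : pt) : pt :=
  tangential NN p (nabla V W p).

(* Half the trace, over an orthonormal basis (e1, e2) of the tangent plane,
   of the shape operator W |-> nabla_W NN. *)
Definition mean_curvature_at (NN : pt -> pt) (Rad : R) (p : pt) (H : R) : Prop :=
  exists e1 e2 : pt,
    tangent_vector (sphere Rad) p e1 /\ tangent_vector (sphere Rad) p e2 /\
    g p e1 e1 = 1 /\ g p e2 e2 = 1 /\ g p e1 e2 = 0 /\
    (g p (nabla (fun _ => e1) NN p) e1
     + g p (nabla (fun _ => e2) NN p) e2) / 2 = H.

(* On (a, b), c lies in the sphere and the tangential part of its covariant
   acceleration vanishes. *)
Definition sphere_geodesic
  (NN : pt -> pt) (Rad : R) (a b : Rbar) (c : R -> pt) : Prop :=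
  exists vel acc : R -> pt, forall u, in_interval a b u ->
    sphere Rad (c u) /\ is_derive c u (vel u) /\ is_derive vel u (acc u) /\
    tangential NN (c u) (plus (acc u) (christoffel (c u) (vel u) (vel u))) = zero.

(* [christoffel] is symmetric and compatible with g, so that [nabla] is
   torsion-free and metric. *)

Hypothesis eps_pos : 0 < eps.

Lemma g_orthonormal (p : pt) :
  g p (X p) (X p) = 1 /\ g p (Y p) (Y p) = 1 /\ g p (T p) (T p) = 1 /\
  g p (X p) (Y p) = 0 /\ g p (X p) (T p) = 0 /\ g p (Y p) (T p) = 0.
Proof.
unfold g, theta, X, Y, T, sigma, cx, cy, ct; destruct p as [[x y] t]; simpl.
repeat split; field; lra.
Qed.

Lemma deriv_along_g (p u v w : pt) :
  deriv_along (fun q => g q u v) p w =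
  - (sigma * (cy w * cx u - cx w * cy u)) * theta p v / eps ^ 4
  - theta p u * (sigma * (cy w * cx v - cx w * cy v)) / eps ^ 4.
Proof.
destruct p as [[p1 p2] p3], u as [[u1 u2] u3], v as [[v1 v2] v3], w as [[w1 w2] w3].
unfold deriv_along, along, g, theta, cx, cy, ct, plus, scal; simpl.
unfold plus, scal; simpl; unfold mult; simpl.
apply is_derive_unique; auto_derive; [easy | field; lra].
Qed.

Lemma christoffel_symmetric (p u v : pt) : christoffel p u v = christoffel p v u.
Proof.
assert (K : forall w, koszul p u v w = koszul p v u w).
{ intro w; unfold koszul; rewrite !deriv_along_g; field; lra. }
unfold christoffel; now rewrite !K.
Qed.

Lemma christoffel_metric (p u v w : pt) :
  deriv_along (fun q => g q u v) p w =
  g p (christoffel p w u) v + g p u (christoffel p w v).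
Proof.
rewrite deriv_along_g; unfold christoffel, koszul; rewrite !deriv_along_g.
destruct p as [[p1 p2] p3], u as [[u1 u2] u3], v as [[v1 v2] v3], w as [[w1 w2] w3].
unfold g, theta, X, Y, T, cx, cy, ct, plus, scal; simpl.
unfold plus, scal; simpl; unfold mult, plus; simpl.
field; lra.
Qed.

End Heisenberg.

(* Main.v *)
Require Import Defs.
From Stdlib Require Import Reals Lra.
From Coquelicot Require Import Coquelicot.
Open Scope R_scope.

(** Write [a = tau * eps] and [w = omega |z|].  The whole geometry becomes explicit after
    replacing the coordinate [t] by a smooth function [k] on [H^1], called [lat] below,
    whose value on the sphere of radius [R] is the signed root of [R^2 - |z|^2].  In the
    coordinates [(x, y, k)] the spheres of the foliation are the round spheres
    [x^2 + y^2 + k^2 = R^2].  The two coordinates are related by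

      [t = eps^3 / (2 a) * ((w^2 + a^2 k^2) * atan (a k / w) + a k w)],

    that is, [2 a t / (eps^3 w^2) = Phi (a k / w)] for the one-variable function
    [Phi q = (1 + q^2) atan q + q].  Since [Phi' = 2 (1 + q atan q) >= 2], it has a smooth
    inverse, so [k] is smooth on all of [H^1], poles and equator included.

    On a fixed sphere [dt = eps^3 w dk].  This describes all tangent vectors
    ([tangent_of_orthogonal]), hence forces the exterior unit normal to be the closed
    formula [normal] ([exterior_unit_normal_unique]).  As [N] is the normalised gradient of
    [R], the field [nabla_N N] is the tangential gradient of [log |grad R|]; by rotational
    symmetry it is orthogonal to the parallels, and it is a positive multiple of [t] times
    the closed formula [meridian] ([nabla_normal_normal]).  So [M] is [meridian] off the
    equator, and on the equator by continuity ([meridian_field_eq]).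

    Along [M] the quantities [r = |z|], [k] and [R] have derivatives [k / (eps R)],
    [- r / (eps R)] and [0].  With these, [nabla_M M = - N / (eps R w^2)]
    ([nabla_meridian_meridian]) and the mean curvature are rational identities modulo
    [r^2 = x^2 + y^2], [w^2 = 1 + a^2 r^2] and [R^2 = r^2 + k^2].

    The same three derivatives integrate the field: along an integral curve [(r, k)] turns
    at the constant speed [1 / (eps R)], and the direction of [z (w + i a k)] does not
    change.  These first integrals identify every integral curve with a piece of an explicit
    curve ([integral_curve_is_meridian]) that runs from the north pole to the south pole in
    time [pi eps R], whence existence, maximality and the limits at both ends. *)

(** * The one-variable function behind the profile of the spheres *)

Definition Phi (q : R) : R := (1 + q ^ 2) * atan q + q.

Lemma is_derive_Phi (q : R) : is_derive Phi q (2 * (1 + q * atan q)).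
Proof.
unfold Phi; auto_derive; [easy |].
unfold Rsqr; field; nra.
Qed.

Lemma mul_atan_nonneg (q : R) : 0 <= q * atan q.
Proof.
destruct (Rtotal_order q 0) as [h | [h | h]].
- pose proof (atan_increasing q 0 h) as h'; rewrite atan_0 in h'; nra.
- subst; lra.
- pose proof (atan_increasing 0 q h) as h'; rewrite atan_0 in h'; nra.
Qed.

(** Expansion gives at once injectivity, surjectivity by the intermediate value
    theorem, and a 1-Lipschitz inverse. *)
Lemma Phi_expands (p q : R) : p <= q -> q - p <= Phi q - Phi p.
Proof.
intro h.
destruct (MVT_gen Phi p q (fun x => 2 * (1 + x * atan x))) as [c [_ hc]].
- intros x _; apply is_derive_Phi.
- intros x _; apply derivable_continuous_pt; eexists; apply is_derive_Reals, is_derive_Phi.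
- rewrite hc; pose proof (mul_atan_nonneg c); nra.
Qed.

Lemma Phi_le_iff (p q : R) : Phi p <= Phi q <-> p <= q.
Proof.
split; intro h.
- destruct (Rle_or_lt p q) as [h' | h']; [easy |].
  pose proof (Phi_expands q p); lra.
- pose proof (Phi_expands p q h); lra.
Qed.

Lemma Phi_opp (q : R) : Phi (- q) = - Phi q.
Proof. unfold Phi; rewrite atan_opp; ring. Qed.

Lemma Phi_surjective (w : R) : {q | Phi q = w}.
Proof.
assert (h0 : Phi 0 = 0) by (unfold Phi; rewrite atan_0; ring).
pose proof (Rabs_pos w) as hw.
pose proof (Phi_expands 0 (Rabs w) hw) as h1.
pose proof (Phi_opp (Rabs w)) as h2.
destruct (IVT_gen Phi (- Rabs w) (Rabs w) w) as [q [_ hq]].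
- intro x; apply derivable_continuous_pt; eexists; apply is_derive_Reals, is_derive_Phi.
- pose proof (Rle_abs w); pose proof (Rle_abs (- w)); rewrite Rabs_Ropp in *.
  rewrite Rmin_left, Rmax_right; lra.
- now exists q.
Qed.

Definition Psi (w : R) : R := proj1_sig (Phi_surjective w).

Lemma Phi_Psi (w : R) : Phi (Psi w) = w.
Proof. exact (proj2_sig (Phi_surjective w)). Qed.

Lemma Psi_contracts (v w : R) : Rabs (Psi w - Psi v) <= Rabs (w - v).
Proof.
rewrite <- (Phi_Psi w) at 2; rewrite <- (Phi_Psi v) at 2.
destruct (Rle_or_lt (Psi v) (Psi w)) as [h | h].
- pose proof (Phi_expands _ _ h).
  rewrite !Rabs_pos_eq; lra.
- pose proof (Phi_expands _ _ (Rlt_le _ _ h)).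
  rewrite !Rabs_left1; lra.
Qed.

(** The increments of [Psi] are dominated by those of the variable, so the difference
    quotient of [Psi] is the reciprocal of a difference quotient of [Phi] at a vanishing step. *)
Lemma is_derive_Psi (w : R) : is_derive Psi w (/ (2 * (1 + Psi w * atan (Psi w)))).
Proof.
set (q := Psi w); set (l := 2 * (1 + q * atan q)).
assert (hl : 2 <= l) by (unfold l; pose proof (mul_atan_nonneg q); lra).
apply is_derive_Reals; intros e he.
assert (hd := proj1 (is_derive_Reals _ _ _) (is_derive_Phi q)).
fold l in hd.
destruct (hd (Rmin 1 e)) as [d hd'].
{ apply Rmin_pos; lra. }
exists d; intros h hne hh.
set (k := Psi (w + h) - q).
assert (hk : Rabs k <= Rabs h).
{ replace h with (w + h - w) by ring; apply Psi_contracts. }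
assert (hPhi : Phi (q + k) - Phi q = h).
{ unfold k, q; replace (Psi w + (Psi (w + h) - Psi w)) with (Psi (w + h)) by ring.
  rewrite !Phi_Psi; ring. }
assert (hk0 : k <> 0).
{ intro h0; rewrite h0, Rplus_0_r in hPhi; lra. }
specialize (hd' k hk0 (Rle_lt_trans _ _ _ hk hh)); rewrite hPhi in hd'.
set (s := h / k) in hd'.
assert (hs : 1 <= s).
{ pose proof (Rmin_l 1 e); apply Rabs_def2 in hd'; lra. }
replace ((Psi (w + h) - Psi w) / h - / l) with ((l - s) / (l * s))
  by (fold q; fold k; unfold s; field; repeat split; try easy; lra).
unfold Rdiv; rewrite Rabs_mult, Rabs_inv, (Rabs_pos_eq (l * s)) by nra.
rewrite <- (Rmult_1_r e).
apply Rle_lt_trans with (Rabs (l - s) * 1).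
- apply Rmult_le_compat_l; [apply Rabs_pos |].
  rewrite <- Rinv_1; apply Rinv_le_contravar; nra.
- rewrite Rmult_1_r, Rmult_1_r, <- Rabs_Ropp, Ropp_minus_distr.
  apply Rlt_le_trans with (1 := hd'); apply Rmin_r.
Qed.

(** * Curves and coordinates *)

Lemma is_derive_linear {V W : NormedModule R_AbsRing} (L : V -> W) (c : R -> V) (u : R) (v : V) :
  is_linear L -> is_derive c u v -> is_derive (fun s => L (c s)) u (L v).
Proof.
intros hL hc; unfold is_derive.
apply filterdiff_ext_lin with (fun y : R => L (scal y v)).
- apply (filterdiff_comp c L (fun y : R => scal y v) L); [exact hc |].
  now apply filterdiff_linear.
- intro y; apply (linear_scal L hL).
Qed.

Lemma is_derive_pair {V W : NormedModule R_AbsRing} (f : R -> V) (h : R -> W) (u : R) (v :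
  V) (w : W) :
  is_derive f u v -> is_derive h u w ->
  @is_derive R_AbsRing (prod_NormedModule R_AbsRing V W) (fun s => (f s, h s)) u (v, w).
Proof.
intros hf hh.
apply (filterdiff_comp'_2 f h (fun a b => (a, b) : prod_NormedModule R_AbsRing V W) u
  (fun y : R => scal y v) (fun y : R => scal y w) (fun a b => (a, b)) hf hh).
apply filterdiff_ext_lin with (fun t => t).
- apply filterdiff_ext with (fun t => t); [now intros [] |].
  apply filterdiff_id.
- now intros [].
Qed.

Lemma pt_eq (p q : pt) : cx p = cx q -> cy p = cy q -> ct p = ct q -> p = q.
Proof.
destruct p as [[]], q as [[]]; unfold cx, cy, ct; simpl; now intros -> -> ->.
Qed.

Lemma is_derive_coordinates (c : R -> pt) (u : R) (v : pt) :
  is_derive c u v <->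
  is_derive (fun s => cx (c s)) u (cx v) /\ is_derive (fun s => cy (c s)) u (cy v) /\
  is_derive (fun s => ct (c s)) u (ct v).
Proof.
split.
- intro h; split; [| split].
  + apply (is_derive_linear fst (fun s => fst (c s)) u (fst v)), (is_derive_linear fst c u v);
      try easy; apply is_linear_fst.
  + apply (is_derive_linear snd (fun s => fst (c s)) u (fst v)), (is_derive_linear fst c u v);
      try easy; first [apply is_linear_fst | apply is_linear_snd].
  + apply (is_derive_linear snd c u v); try easy; apply is_linear_snd.
- intros [h1 [h2 h3]].
  destruct v as [[v1 v2] v3].
  apply is_derive_ext with (fun s => (cx (c s), cy (c s), ct (c s))).
  + intro s; now destruct (c s) as [[]].
  + now repeat apply is_derive_pair.
Qed.

Lemma cx_mk (u v w : R) : cx (u, v, w) = u. Proof. easy. Qed.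
Lemma cy_mk (u v w : R) : cy (u, v, w) = v. Proof. easy. Qed.
Lemma ct_mk (u v w : R) : ct (u, v, w) = w. Proof. easy. Qed.
Lemma cx_plus (p q : pt) : cx (plus p q) = cx p + cx q. Proof. easy. Qed.
Lemma cy_plus (p q : pt) : cy (plus p q) = cy p + cy q. Proof. easy. Qed.
Lemma ct_plus (p q : pt) : ct (plus p q) = ct p + ct q. Proof. easy. Qed.
Lemma cx_scal (h : R) (p : pt) : cx (scal h p) = h * cx p. Proof. easy. Qed.
Lemma cy_scal (h : R) (p : pt) : cy (scal h p) = h * cy p. Proof. easy. Qed.
Lemma ct_scal (h : R) (p : pt) : ct (scal h p) = h * ct p. Proof. easy. Qed.

Ltac coords :=
  rewrite ?cx_plus, ?cy_plus, ?ct_plus, ?cx_scal, ?cy_scal, ?ct_scal, ?cx_mk, ?cy_mk, ?ct_mk.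

Ltac nonzero := repeat split; first [easy | apply Rgt_not_eq; lra | lra].

Ltac rewrite_derivatives :=
  repeat match goal with
  | H : is_derive ?f ?u ?l |- context [Derive ?h ?u] =>
      replace (Derive h u) with l by (symmetry; exact (is_derive_unique f u l H))
  end.

Lemma continuous_cx (p : pt) : continuous cx p.
Proof. apply (continuous_comp fst fst); destruct p as [[]]; apply continuous_fst. Qed.

Lemma continuous_cy (p : pt) : continuous cy p.
Proof.
apply (continuous_comp fst snd); destruct p as [[]]; [apply continuous_fst | apply continuous_snd].
Qed.

Lemma continuous_ct (p : pt) : continuous ct p.
Proof. destruct p as [[]]; apply continuous_snd. Qed.

Lemma continuous_line (p v : pt) (h : R) : continuous (fun h : R => plus p (scal h v)) h.
Proof.
apply (continuous_plus (fun _ => p) (fun h : R => scal h v)).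
- apply continuous_const.
- apply (continuous_scal_l (fun h : R => h) v), continuous_id.
Qed.

Lemma plus_scal_0 (p v : pt) : plus p (scal 0 v) = p.
Proof.
replace (scal 0 v) with (zero : pt) by (symmetry; exact (scal_zero_l v)).
apply plus_zero_r.
Qed.

Lemma is_derive_line (p v : pt) : is_derive (fun h : R => plus p (scal h v)) 0 v.
Proof.
destruct p as [[p1 p2] p3], v as [[v1 v2] v3].
apply is_derive_coordinates; unfold cx, cy, ct; simpl; unfold plus, scal; simpl; unfold mult; simpl.
split; [| split]; auto_derive; try easy; ring.
Qed.

Lemma curve_continuous (c : R -> pt) (u : R) (v : pt) : is_derive c u v -> continuous c u.
Proof. intro h; apply (ex_derive_continuous c); now exists v. Qed.

Lemma field_deriv_eq (W : pt -> pt) (p v D : pt) :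
  is_derive (fun h : R => W (plus p (scal h v))) 0 D -> field_deriv W p v = D.
Proof.
intro h; apply is_derive_coordinates in h; destruct h as [h1 [h2 h3]].
apply pt_eq; apply is_derive_unique; assumption.
Qed.

(** Serves to exclude the inward normal: along it the radius decreases, while the points
    beyond the sphere should lie outside the ball. *)
Lemma descends_right (f : R -> R) (l : R) (P : R -> Prop) :
  is_derive f 0 l -> l < 0 -> at_right 0 P -> exists h, P h /\ f h < f 0.
Proof.
intros hf hl [d hP].
destruct (proj1 (is_derive_Reals _ _ _) hf (- l)) as [d' hd']; [lra |].
set (h := Rmin d d' / 2).
assert (h0 : 0 < h /\ h < d /\ h < d').
{ pose proof (cond_pos d); pose proof (cond_pos d').
  pose proof (Rmin_l d d'); pose proof (Rmin_r d d').
  assert (0 < Rmin d d') by (now apply Rmin_pos).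
  unfold h; lra. }
destruct h0 as [h0 [h1 h2]].
exists h; split.
- apply hP; [| easy].
  unfold ball; simpl; unfold AbsRing_ball, abs, minus, plus, opp; simpl.
  rewrite Rabs_pos_eq; lra.
- specialize (hd' h); rewrite (Rabs_pos_eq h), Rplus_0_l in hd' by lra.
  specialize (hd' (Rgt_not_eq _ _ h0) h2); apply Rabs_def2 in hd'.
  assert (e : (f h - f 0) / h < 0) by lra.
  apply (Rmult_lt_compat_r h) in e; [| easy].
  unfold Rdiv in e; rewrite Rmult_assoc, Rinv_l in e; lra.
Qed.

Lemma eq_along_curve (F G : pt -> R) (c : R -> pt) :
  continuous c 0 -> continuous F (c 0) -> continuous G (c 0) ->
  at_right 0 (fun h => F (c h) = G (c h)) -> F (c 0) = G (c 0).
Proof.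
intros hc hF hG e.
assert (right : forall K : pt -> R, continuous K (c 0) ->
  filterlim (fun h => K (c h)) (at_right 0) (locally (K (c 0)))).
{ intros K hK; apply filterlim_filter_le_1 with (2 := continuous_comp c K 0 hc hK).
  apply filter_le_within. }
apply (filterlim_locally_unique (F := at_right 0) (fun h => F (c h))); [now apply right |].
apply filterlim_ext_loc with (fun h => G (c h)); [| now apply right].
apply filter_imp with (2 := e); now intros.
Qed.

Lemma constant_on_interval (a b : Rbar) (f : R -> R) (u v : R) :
  (forall s, in_interval a b s -> is_derive f s 0) ->
  in_interval a b u -> in_interval a b v -> f u = f v.
Proof.
intros hf.
assert (main : forall u v, u < v -> in_interval a b u -> in_interval a b v -> f u = f v).
{ intros s t hst [hs _] [_ ht]; apply (eq_is_derive f); [| easy].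
  intros r hr; apply hf; split.
  - apply Rbar_lt_le_trans with s; [easy | apply hr].
  - apply Rbar_le_lt_trans with t; [apply hr | easy]. }
intros hu hv; destruct (Rtotal_order u v) as [h | [-> | h]]; auto; symmetry; auto.
Qed.

Lemma interval_inhabited (b1 b2 : Rbar) : Rbar_lt b1 b2 -> exists u, in_interval b1 b2 u.
Proof.
unfold in_interval; destruct b1 as [x | |], b2 as [y | |]; simpl; intro h; try easy.
- exists ((x + y) / 2); simpl; lra.
- exists (x + 1); simpl; split; [lra | easy].
- exists (y - 1); simpl; split; [easy | lra].
- now exists 0.
Qed.

(** * Calculus of smooth functions on open sets *)

Lemma locally_line (U : pt -> Prop) (p v : pt) :
  open U -> U p -> locally 0 (fun h : R => U (plus p (scal h v))).
Proof.
intros oU hp.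
apply (continuous_line p v 0); rewrite plus_scal_0; now apply oU.
Qed.

Lemma is_derive_along_ext (U : pt -> Prop) (F G : pt -> R) (p v : pt) (l : R) :
  open U -> U p -> (forall q, U q -> F q = G q) ->
  is_derive (along F p v) 0 l -> is_derive (along G p v) 0 l.
Proof.
intros oU hp e; apply is_derive_ext_loc.
apply filter_imp with (2 := locally_line U p v oU hp).
intros h hU; now apply e.
Qed.

Lemma deriv_along_ext (U : pt -> Prop) (F G : pt -> R) (p v : pt) :
  open U -> U p -> (forall q, U q -> F q = G q) -> deriv_along F p v = deriv_along G p v.
Proof.
intros oU hp e; apply Derive_ext_loc.
apply filter_imp with (2 := locally_line U p v oU hp).
intros h hU; now apply e.
Qed.

Lemma continuous_ext_open (U : pt -> Prop) (F G : pt -> R) (p : pt) :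
  open U -> U p -> (forall q, U q -> F q = G q) -> continuous F p -> continuous G p.
Proof.
intros oU hp e; apply continuous_ext_loc.
apply filter_imp with (2 := oU p hp); intros q hq; now apply e.
Qed.

Lemma Ck_continuous (k : nat) (U : pt -> Prop) (F : pt -> R) (p : pt) :
  Ck k U F -> U p -> continuous F p.
Proof. destruct k; intros [h _]; exact (h p). Qed.

Lemma Ck_S (k : nat) (U : pt -> Prop) (F : pt -> R) : Ck (S k) U F -> Ck k U F.
Proof.
revert F; induction k as [| k IH]; intros F [h1 h2]; split; try easy.
intro v; destruct (h2 v) as [h3 h4]; split; [easy | now apply IH].
Qed.

Lemma Ck_is_derive (k : nat) (U : pt -> Prop) (F : pt -> R) (p v : pt) :
  Ck (S k) U F -> U p -> is_derive (along F p v) 0 (deriv_along F p v).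
Proof. intros [_ h] hp; apply Derive_correct; now apply (h v). Qed.

Section Smooth.

Variables (U : pt -> Prop) (oU : open U).

Lemma Ck_ext (k : nat) (F G : pt -> R) :
  (forall p, U p -> F p = G p) -> Ck k U F -> Ck k U G.
Proof.
revert F G; induction k as [| k IH]; intros F G e [h1 h2]; split.
1, 3 : intros p hp; apply (continuous_ext_open U F G); auto.
- easy.
- intro v; destruct (h2 v) as [h3 h4]; split.
  + intros p hp; destruct (h3 p hp) as [l hl]; exists l.
    now apply (is_derive_along_ext U F G).
  + apply IH with (2 := h4); intros p hp; now apply deriv_along_ext with U.
Qed.

(** All closure properties below go through this lemma: a formula for the directional
    derivatives that only involves functions of class C^k makes [F] of class C^(k+1). *)
Lemma Ck_step (k : nat) (F : pt -> R) (G : pt -> pt -> R) :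
  (forall p, U p -> continuous F p) ->
  (forall v p, U p -> is_derive (along F p v) 0 (G v p)) ->
  (forall v, Ck k U (G v)) -> Ck (S k) U F.
Proof.
intros c d h; split; [easy |]; intro v; split.
- intros p hp; exists (G v p); now apply d.
- apply Ck_ext with (G v); [| easy].
  intros p hp; symmetry; now apply is_derive_unique, d.
Qed.

Lemma Ck_const (k : nat) (c : R) : Ck k U (fun _ => c).
Proof.
revert c; induction k as [| k IH]; intro c.
- split; [intros; apply continuous_const | easy].
- apply Ck_step with (fun _ _ => 0); [| | easy].
  + intros; apply continuous_const.
  + intros v p _; apply (is_derive_const c).
Qed.

Lemma Ck_coordinate (k : nat) (L : pt -> R) :
  (forall p, continuous L p) -> (forall p v h, L (plus p (scal h v)) = L p + h * L v) ->
  Ck k U L.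
Proof.
intros c lin; destruct k as [| k].
- now split.
- apply Ck_step with (fun v _ => L v); [easy | | intro; apply Ck_const].
  intros v p _; unfold along.
  apply is_derive_ext with (fun h => L p + h * L v); [intro h; now rewrite lin |].
  auto_derive; [easy | ring].
Qed.

Lemma Ck_plus (k : nat) (F G : pt -> R) :
  Ck k U F -> Ck k U G -> Ck k U (fun p => F p + G p).
Proof.
revert F G; induction k as [| k IH]; intros F G hF hG.
- split; [| easy]; intros p hp.
  apply (continuous_plus F G); eapply Ck_continuous; eauto.
- apply Ck_step with (fun v p => deriv_along F p v + deriv_along G p v).
  + intros p hp; apply (continuous_plus F G); eapply Ck_continuous; eauto.
  + intros v p hp; apply (is_derive_plus (along F p v) (along G p v));
      eapply Ck_is_derive; eauto.
  + intro v; apply IH; [apply (proj2 hF v) | apply (proj2 hG v)].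
Qed.

Lemma Ck_mult (k : nat) (F G : pt -> R) :
  Ck k U F -> Ck k U G -> Ck k U (fun p => F p * G p).
Proof.
revert F G; induction k as [| k IH]; intros F G hF hG.
- split; [| easy]; intros p hp.
  apply (continuous_mult F G); eapply Ck_continuous; eauto.
- apply Ck_step with (fun v p => deriv_along F p v * G p + F p * deriv_along G p v).
  + intros p hp; apply (continuous_mult F G); eapply Ck_continuous; eauto.
  + intros v p hp.
    assert (h := is_derive_mult (along F p v) (along G p v) 0 _ _
      (Ck_is_derive k U F p v hF hp) (Ck_is_derive k U G p v hG hp) Rmult_comm).
    unfold along at 3 4 in h; rewrite plus_scal_0 in h; exact h.
  + intro v; apply Ck_plus; apply IH;
      try apply (proj2 hF v); try apply (proj2 hG v); now apply Ck_S.
Qed.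

(** The derivative [f'] of each elementary function used here can be written with
    [f] and simpler functions, so that the smoothness of [f] bootstraps itself: this is what
    the hypothesis linking [f] to [f'] expresses. *)
Lemma Ck_comp (f f' : R -> R) (D : R -> Prop) :
  (forall x, D x -> is_derive f x (f' x)) ->
  (forall k F, (forall p, U p -> D (F p)) -> Ck k U F ->
     Ck k U (fun p => f (F p)) -> Ck k U (fun p => f' (F p))) ->
  forall k F, (forall p, U p -> D (F p)) -> Ck k U F -> Ck k U (fun p => f (F p)).
Proof.
intros df hf' k; induction k as [| k IH]; intros F hD hF.
all: assert (c : forall p, U p -> continuous (fun p => f (F p)) p)
  by (intros p hp; apply continuous_comp; [eapply Ck_continuous; eauto |];
      apply (ex_derive_continuous f); eexists; apply df; auto).
- now split.
- apply Ck_step with (fun v p => deriv_along F p v * f' (F p)); [easy | |].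
  + intros v p hp; unfold along.
    apply (is_derive_comp f (along F p v)).
    * unfold along; rewrite plus_scal_0; apply df; auto.
    * eapply Ck_is_derive; eauto.
  + intro v; apply Ck_mult; [apply (proj2 hF v) |].
    apply Ck_S in hF; auto.
Qed.

Lemma Ck_inv (k : nat) (F : pt -> R) :
  (forall p, U p -> F p <> 0) -> Ck k U F -> Ck k U (fun p => / F p).
Proof.
apply (Ck_comp Rinv (fun x => (-1) * (/ x * / x)) (fun x => x <> 0)).
- intros x hx; auto_derive; [easy | field; easy].
- intros j G _ _ h; apply Ck_mult; [apply Ck_const | now apply Ck_mult].
Qed.

Lemma Ck_sqrt (k : nat) (F : pt -> R) :
  (forall p, U p -> 0 < F p) -> Ck k U F -> Ck k U (fun p => sqrt (F p)).
Proof.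
apply (Ck_comp sqrt (fun x => / (2 * sqrt x)) (fun x => 0 < x)).
- intros x hx; auto_derive; [easy |]; pose proof (sqrt_lt_R0 x hx); field; lra.
- intros j G hG _ h; apply Ck_inv.
  + intros p hp; pose proof (sqrt_lt_R0 _ (hG p hp)); lra.
  + apply Ck_mult; [apply Ck_const | easy].
Qed.

Lemma Ck_atan (k : nat) (F : pt -> R) : Ck k U F -> Ck k U (fun p => atan (F p)).
Proof.
apply (Ck_comp atan (fun x => / (1 + x * x)) (fun _ => True)); [| | easy].
- intros x _; auto_derive; [easy | unfold Rsqr; field; nra].
- intros j G _ h _; apply Ck_inv; [intros; nra |].
  apply Ck_plus; [apply Ck_const | now apply Ck_mult].
Qed.

Lemma Ck_Psi (k : nat) (F : pt -> R) : Ck k U F -> Ck k U (fun p => Psi (F p)).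
Proof.
apply (Ck_comp Psi (fun x => / (2 * (1 + Psi x * atan (Psi x)))) (fun _ => True)); [| | easy].
- intros x _; apply is_derive_Psi.
- intros j G _ _ h; apply Ck_inv.
  + intros p _; pose proof (mul_atan_nonneg (Psi (G p))); lra.
  + repeat first [apply Ck_mult | apply Ck_plus | apply Ck_const | apply Ck_atan]; easy.
Qed.

Lemma smooth_const (r : R) : smooth U (fun _ => r).
Proof. intro k; now apply Ck_const. Qed.

Lemma smooth_plus (F G : pt -> R) : smooth U F -> smooth U G -> smooth U (fun p => F p + G p).
Proof. intros hF hG k; now apply Ck_plus. Qed.

Lemma smooth_mult (F G : pt -> R) : smooth U F -> smooth U G -> smooth U (fun p => F p * G p).
Proof. intros hF hG k; now apply Ck_mult. Qed.

Lemma smooth_opp (F : pt -> R) : smooth U F -> smooth U (fun p => - F p).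
Proof.
intros hF k; apply Ck_ext with (fun p => -1 * F p); [intros; ring |].
apply Ck_mult; auto; now apply Ck_const.
Qed.

Lemma smooth_minus (F G : pt -> R) : smooth U F -> smooth U G -> smooth U (fun p => F p - G p).
Proof. intros hF hG; apply smooth_plus; [easy | now apply smooth_opp]. Qed.

Lemma smooth_pow (F : pt -> R) (n : nat) : smooth U F -> smooth U (fun p => F p ^ n).
Proof.
intro hF; induction n as [| n IH]; simpl; [apply smooth_const | now apply smooth_mult].
Qed.

Lemma smooth_div (F G : pt -> R) :
  (forall p, U p -> G p <> 0) -> smooth U F -> smooth U G -> smooth U (fun p => F p / G p).
Proof. intros h hF hG k; apply Ck_mult; auto; now apply Ck_inv. Qed.

Lemma smooth_sqrt (F : pt -> R) :
  (forall p, U p -> 0 < F p) -> smooth U F -> smooth U (fun p => sqrt (F p)).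
Proof. intros h hF k; now apply Ck_sqrt. Qed.

Lemma smooth_Psi (F : pt -> R) : smooth U F -> smooth U (fun p => Psi (F p)).
Proof. intros hF k; now apply Ck_Psi. Qed.

Lemma smooth_cx : smooth U cx.
Proof. intro k; apply Ck_coordinate; [apply continuous_cx | easy]. Qed.

Lemma smooth_cy : smooth U cy.
Proof. intro k; apply Ck_coordinate; [apply continuous_cy | easy]. Qed.

Lemma smooth_ct : smooth U ct.
Proof. intro k; apply Ck_coordinate; [apply continuous_ct | easy]. Qed.

Lemma smooth_field_mk (F G H : pt -> R) :
  smooth U F -> smooth U G -> smooth U H -> smooth_field U (fun p => (F p, G p, H p)).
Proof. intros hF hG hH; split; [exact hF | split; [exact hG | exact hH]]. Qed.

End Smooth.

Ltac smooth_tac :=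
  repeat first
    [ assumption | apply smooth_cx | apply smooth_cy | apply smooth_ct | apply smooth_const
    | apply smooth_minus | apply smooth_plus | apply smooth_opp | apply smooth_div | apply
      smooth_mult
    | apply smooth_pow | apply smooth_Psi | apply smooth_sqrt ].

Lemma normz_sqr (p : pt) : normz p ^ 2 = cx p ^ 2 + cy p ^ 2.
Proof. unfold normz; apply pow2_sqrt; nra. Qed.

Lemma normz_nonneg (p : pt) : 0 <= normz p.
Proof. apply sqrt_pos. Qed.

Lemma normz_eq_0 (p : pt) : normz p = 0 -> cx p = 0 /\ cy p = 0.
Proof. intro h; pose proof (normz_sqr p) as e; rewrite h in e; nra. Qed.

Lemma open_normz : open (fun p => 0 < normz p).
Proof.
apply (open_comp normz (fun r => 0 < r)); [| apply open_gt].
intros p _; apply (continuous_comp (fun p : pt => cx p ^ 2 + cy p ^ 2) sqrt);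
  [| apply continuous_sqrt].
apply (Ck_continuous 0 (fun _ => True)); [| easy].
assert (smooth (fun _ => True) (fun p => cx p ^ 2 + cy p ^ 2)); [| auto].
assert (oT : open (fun _ : pt => True)) by apply open_true.
smooth_tac.
Qed.

(** * The spheres as round spheres *)

Section Geometry.

Variables eps tau : R.
Hypothesis eps_pos : 0 < eps.
Hypothesis tau_neq0 : tau <> 0.

Definition twist : R := tau * eps.

Notation a := twist.
Notation g := (g eps tau).

Lemma twist_neq0 : a <> 0.
Proof. unfold twist; apply Rmult_integral_contrapositive; lra. Qed.

Lemma sigma_twist : Defs.sigma eps tau = a * eps ^ 3.
Proof. unfold Defs.sigma, twist; ring. Qed.

Definition om (p : pt) : R := sqrt (1 + a ^ 2 * (cx p ^ 2 + cy p ^ 2)).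

Lemma om_sqr (p : pt) : om p ^ 2 = 1 + a ^ 2 * (cx p ^ 2 + cy p ^ 2).
Proof. unfold om; rewrite pow2_sqrt; [easy |]; nra. Qed.

Lemma om_pos (p : pt) : 0 < om p.
Proof. apply sqrt_lt_R0; nra. Qed.

Lemma omega_normz (p : pt) : omega eps tau (normz p) = om p.
Proof. unfold omega, om; f_equal; rewrite normz_sqr; unfold twist; ring. Qed.

(** The value of [t] at a point with [omega |z| = w] and [lat = k].  For [k] the
    nonnegative root of [Rad^2 - |z|^2] it is the profile of the sphere of radius [Rad]. *)
Definition height (w k : R) : R :=
  eps ^ 3 / (2 * a) * ((w ^ 2 + a ^ 2 * k ^ 2) * atan (a * k / w) + a * k * w).

Lemma height_Phi (w k : R) :
  0 < w -> height w k = eps ^ 3 * w ^ 2 / (2 * a) * Phi (a * k / w).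
Proof.
intro hw; unfold height, Phi; pose proof twist_neq0; field; nonzero.
Qed.

Lemma height_opp (w k : R) : height w (- k) = - height w k.
Proof.
unfold height; replace (a * - k / w) with (- (a * k / w)) by (unfold Rdiv; ring).
rewrite atan_opp; ring.
Qed.

(** As [Phi] is odd, [Phi (a m) / a] is increasing in [m] for either sign of [a]. *)
Lemma height_le_iff (w k l : R) : 0 < w -> height w k <= height w l <-> k <= l.
Proof.
intro hw; pose proof twist_neq0 as ha.
rewrite !height_Phi by easy.
set (C := eps ^ 3 * w ^ 2 / (2 * Rabs a)).
assert (hC : 0 < C).
{ unfold C; pose proof (Rabs_pos_lt _ ha).
  apply Rdiv_lt_0_compat; [| lra]; apply Rmult_lt_0_compat; now apply pow_lt. }
assert (e : forall m, eps ^ 3 * w ^ 2 / (2 * a) * Phi (a * m / w)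
  = C * Phi (Rabs a / w * m)).
{ intro m; unfold C; destruct (Rle_or_lt 0 a).
  - rewrite Rabs_pos_eq by easy; f_equal; f_equal; field; nonzero.
  - rewrite Rabs_left by easy.
    replace (- a / w * m) with (- (a * m / w)) by (field; nonzero).
    rewrite Phi_opp; field; nonzero. }
rewrite !e.
assert (hd : 0 < Rabs a / w) by (apply Rdiv_lt_0_compat; [now apply Rabs_pos_lt | easy]).
split; intro h.
- apply Rmult_le_reg_l with (1 := hd), Phi_le_iff, Rmult_le_reg_l with (1 := hC), h.
- apply Rmult_le_compat_l; [lra |]; apply Phi_le_iff, Rmult_le_compat_l; [lra | easy].
Qed.

Lemma height_inj (w k l : R) : 0 < w -> height w k = height w l -> k = l.
Proof. intros hw h; apply Rle_antisym; apply (height_le_iff w); auto; lra. Qed.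

Lemma height_0 (w : R) : height w 0 = 0.
Proof. unfold height; rewrite Rmult_0_r; unfold Rdiv; rewrite Rmult_0_l, atan_0; ring. Qed.

Lemma Rabs_height (w k : R) : 0 < w -> Rabs (height w k) = height w (Rabs k).
Proof.
intro hw; pose proof (height_0 w).
destruct (Rle_or_lt 0 k) as [h | h].
- rewrite !Rabs_pos_eq; try easy.
  apply (height_le_iff w) in h; [| exact hw]; lra.
- rewrite (Rabs_left k), height_opp by easy; apply Rabs_left1.
  apply Rlt_le, (height_le_iff w) in h; [| exact hw]; lra.
Qed.

(** The solution [k] of [height (om p) k = ct p], the signed companion of [|z|] on the
    sphere through [p]. *)
Definition lat (p : pt) : R := om p / a * Psi (2 * a * ct p / (eps ^ 3 * om p ^ 2)).

Lemma height_lat (p : pt) : height (om p) (lat p) = ct p.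
Proof.
pose proof (om_pos p); pose proof twist_neq0.
rewrite height_Phi by easy; unfold lat.
match goal with |- context [Phi ?q] => replace q with
  (Psi (2 * a * ct p / (eps ^ 3 * om p ^ 2))) by (field; nonzero) end.
rewrite Phi_Psi; field; nonzero.
Qed.

Lemma lat_unique (p : pt) (k : R) : ct p = height (om p) k -> lat p = k.
Proof.
intro h; apply (height_inj (om p)); [apply om_pos | now rewrite height_lat].
Qed.

(** The square of the radius of the sphere through [p]. *)
Definition rad2 (p : pt) : R := cx p ^ 2 + cy p ^ 2 + lat p ^ 2.

(** The formula for the profile contains [omega Rad ^ 2], which is [w^2 + a^2 k^2] when
    [|z|^2 + k^2 = Rad^2]. *)
Lemma profile_height (r Rad : R) :
  0 <= r <= Rad -> profile eps tau r Rad = height (omega eps tau r) (sqrt (Rad ^ 2 - r ^ 2)).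
Proof.
intro h; unfold profile, height.
assert (hR : omega eps tau Rad ^ 2 =
  omega eps tau r ^ 2 + a ^ 2 * sqrt (Rad ^ 2 - r ^ 2) ^ 2).
{ unfold omega; rewrite !pow2_sqrt; unfold twist; nra. }
rewrite hR; unfold twist; set (w := omega eps tau r); set (s := sqrt _).
replace (tau * eps * (s / w)) with (tau * eps * s / w) by (unfold Rdiv; ring).
field; split; lra.
Qed.

Lemma sqrt_sqr_minus_le (k r Rad : R) :
  0 <= r <= Rad -> Rabs k <= sqrt (Rad ^ 2 - r ^ 2) <-> r ^ 2 + k ^ 2 <= Rad ^ 2.
Proof.
intro h; assert (0 <= Rad ^ 2 - r ^ 2) by nra.
pose proof (Rabs_pos k) as hk; pose proof (sqrt_pos (Rad ^ 2 - r ^ 2)) as hs.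
pose proof (pow2_abs k) as e1; pose proof (pow2_sqrt (Rad ^ 2 - r ^ 2) H) as e2.
split; intro; nra.
Qed.

Lemma ball_iff (Rad : R) (p : pt) :
  0 < Rad -> ball_region eps tau Rad p <-> rad2 p <= Rad ^ 2.
Proof.
intro hR; unfold ball_region, rad2; rewrite <- (normz_sqr p).
pose proof (normz_nonneg p); pose proof (om_pos p).
split.
- intros [h1 h2]; rewrite profile_height, omega_normz, <- height_lat, Rabs_height,
    height_le_iff, sqrt_sqr_minus_le in h2; try easy; nra.
- intro h; assert (h1 : normz p <= Rad) by nra; split; [easy |].
  rewrite profile_height, omega_normz, <- height_lat, Rabs_height,
    height_le_iff, sqrt_sqr_minus_le; try easy; nra.
Qed.

Lemma sphere_iff (Rad : R) (p : pt) :
  0 < Rad -> sphere eps tau Rad p <-> rad2 p = Rad ^ 2.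
Proof.
intro hR; unfold sphere, rad2; rewrite <- (normz_sqr p).
pose proof (normz_nonneg p) as hn; pose proof (om_pos p) as ho.
assert (e : normz p <= Rad -> Rabs (ct p) = profile eps tau (normz p) Rad <->
  Rabs (lat p) = sqrt (Rad ^ 2 - normz p ^ 2)).
{ intro h; rewrite profile_height, omega_normz, <- height_lat, Rabs_height by easy.
  split; [now apply height_inj | now intros ->]. }
split.
- intros [h1 h2]; apply e in h2; [| easy].
  rewrite <- (pow2_abs (lat p)), h2, pow2_sqrt; nra.
- intro h; assert (h1 : normz p <= Rad) by nra; split; [easy |].
  apply e; [easy |].
  rewrite <- h; replace (_ - _) with (lat p ^ 2) by ring.
  now rewrite <- pow2_abs, sqrt_pow2 by apply Rabs_pos.
Qed.

(** The inverse of the change of coordinates from [p] to [(cx p, cy p, lat p)]. *)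
Definition from_round (x y k : R) : pt := (x, y, height (sqrt (1 + a ^ 2 * (x ^ 2 + y ^ 2))) k).

Lemma om_from_round (x y k : R) :
  om (from_round x y k) = sqrt (1 + a ^ 2 * (x ^ 2 + y ^ 2)).
Proof. easy. Qed.

Lemma lat_from_round (x y k : R) : lat (from_round x y k) = k.
Proof. now apply lat_unique. Qed.

Lemma rad2_from_round (x y k : R) : rad2 (from_round x y k) = x ^ 2 + y ^ 2 + k ^ 2.
Proof. unfold rad2; now rewrite lat_from_round. Qed.

Lemma from_round_lat (p : pt) : from_round (cx p) (cy p) (lat p) = p.
Proof. apply pt_eq; try easy; apply height_lat; easy. Qed.

Lemma north_from_round (Rad : R) : 0 < Rad -> north eps tau Rad = from_round 0 0 Rad.
Proof.
intro h; unfold north, from_round; rewrite profile_height by (try easy; lra).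
f_equal; f_equal.
- unfold omega; f_equal; ring.
- replace (Rad ^ 2 - 0 ^ 2) with (Rad ^ 2) by ring; apply sqrt_pow2; lra.
Qed.

Lemma south_from_round (Rad : R) : 0 < Rad -> south eps tau Rad = from_round 0 0 (- Rad).
Proof.
intro h; pose proof (f_equal ct (north_from_round Rad h)) as e.
unfold north, from_round in e; rewrite !ct_mk in e.
unfold south, from_round; now rewrite e, height_opp.
Qed.

Lemma normz_from_round_0 (k : R) : normz (from_round 0 0 k) = 0.
Proof.
unfold normz, from_round; rewrite cx_mk, cy_mk.
replace (0 ^ 2 + 0 ^ 2) with 0 by ring; apply sqrt_0.
Qed.

Lemma sphere_star_iff (Rad : R) (p : pt) :
  0 < Rad -> sphere_star eps tau Rad p <-> sphere eps tau Rad p /\ 0 < normz p.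
Proof.
intro hR; unfold sphere_star; rewrite north_from_round, south_from_round by easy.
split.
- intros [hp [hn hs]]; split; [easy |].
  destruct (normz_nonneg p) as [h | h]; [easy | exfalso].
  apply eq_sym, normz_eq_0 in h; destruct h as [hx hy].
  apply sphere_iff in hp; try easy; unfold rad2 in hp.
  pose proof (from_round_lat p) as e; rewrite hx, hy in e, hp.
  assert (lat p = Rad \/ lat p = - Rad) as [h | h]
    by (destruct (Rle_or_lt 0 (lat p)); [left | right]; nra);
    rewrite h in e; now symmetry in e.
- intros [hp hr]; split; [easy |].
  split; intros ->; rewrite normz_from_round_0 in hr; lra.
Qed.

Definition rad (p : pt) : R := sqrt (rad2 p).

Lemma rad2_nonneg (p : pt) : 0 <= rad2 p.
Proof. unfold rad2; nra. Qed.

Lemma rad_sqr (p : pt) : rad p ^ 2 = cx p ^ 2 + cy p ^ 2 + lat p ^ 2.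
Proof. unfold rad; rewrite pow2_sqrt; [easy | apply rad2_nonneg]. Qed.

Lemma rad_pos (p : pt) : 0 < rad2 p -> 0 < rad p.
Proof. apply sqrt_lt_R0. Qed.

Lemma rad2_normz (p : pt) : 0 < normz p -> 0 < rad2 p.
Proof. intro h; unfold rad2; rewrite <- (normz_sqr p); nra. Qed.

Lemma sphere_rad (Rad : R) (p : pt) : 0 < Rad -> sphere eps tau Rad p -> rad p = Rad.
Proof.
intros hR h; apply sphere_iff in h; try easy.
unfold rad; rewrite h; apply sqrt_pow2; lra.
Qed.

Lemma rad2_sphere (Rad : R) (p : pt) : 0 < Rad -> sphere eps tau Rad p -> 0 < rad2 p.
Proof. intros hR h; apply sphere_iff in h; try easy; rewrite h; nra. Qed.

Lemma on_own_sphere (p : pt) : 0 < rad2 p -> sphere eps tau (rad p) p.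
Proof.
intro h; apply sphere_iff; try easy; [now apply rad_pos |].
unfold rad; rewrite pow2_sqrt; lra.
Qed.

(** * Differentials of the coordinate functions *)

Definition ang (p : pt) : R := atan (a * lat p / om p).

(** Up to the factor [eps^3], the partial derivative of [height] in [k]: it is the
    denominator of the differential of [lat], and [|grad rad| = om / (eps * den)]. *)
Definition den (p : pt) : R := om p + a * lat p * ang p.

Lemma den_pos (p : pt) : 0 < den p.
Proof.
unfold den, ang; pose proof (om_pos p); pose proof (mul_atan_nonneg (a * lat p / om p)) as h.
assert (e : a * lat p * atan (a * lat p / om p) =
  om p * (a * lat p / om p * atan (a * lat p / om p))) by (field; nonzero).
rewrite e; nra.
Qed.

Definition dom (p v : pt) : R := a ^ 2 * (cx p * cx v + cy p * cy v) / om p.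

Definition dlat (p v : pt) : R :=
  (ct v / eps ^ 3 - a * ang p * (cx p * cx v + cy p * cy v)) / den p.

Lemma is_derive_om (c : R -> pt) (u : R) (v : pt) :
  is_derive c u v -> is_derive (fun s => om (c s)) u (dom (c u) v).
Proof.
intro hc; apply is_derive_coordinates in hc; destruct hc as [hx [hy _]].
pose proof (om_pos (c u)) as ho.
unfold dom; unfold om in *.
set (x := fun s => cx (c s)) in *; set (y := fun s => cy (c s)) in *.
change (is_derive (fun s => sqrt (1 + a ^ 2 * (x s ^ 2 + y s ^ 2))) u
 (a ^ 2 * (x u * cx v + y u * cy v) / sqrt (1 + a ^ 2 * (x u ^ 2 + y u ^ 2)))).
change (0 < sqrt (1 + a ^ 2 * (x u ^ 2 + y u ^ 2))) in ho.
auto_derive.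
- repeat split; try (eexists; eassumption); nra.
- rewrite_derivatives.
  simpl in *; field; lra.
Qed.

(** Implicit differentiation of [ct p = height (om p) (lat p)]. *)
Lemma is_derive_lat (c : R -> pt) (u : R) (v : pt) :
  is_derive c u v -> is_derive (fun s => lat (c s)) u (dlat (c u) v).
Proof.
intro hc; pose proof (is_derive_om c u v hc) as ho.
apply is_derive_coordinates in hc; destruct hc as [hx [hy ht]].
pose proof (om_pos (c u)) as op; pose proof twist_neq0 as ha.
pose proof (den_pos (c u)) as dp; pose proof (om_sqr (c u)) as o2.
set (q := 2 * a * ct (c u) / (eps ^ 3 * om (c u) ^ 2)).
pose proof (is_derive_Psi q) as hq.
assert (eq : Psi q = a * lat (c u) / om (c u)) by (unfold lat; fold q; field; nonzero).
assert (et : ct (c u) = eps ^ 3 * om (c u) ^ 2 / (2 * a) * Phi (a * lat (c u) / om (c u)))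
  by (rewrite <- height_Phi by easy; symmetry; apply height_lat).
assert (e1 : is_derive (fun s => Psi (2 * a * ct (c s) / (eps ^ 3 * om (c s) ^ 2))) u
  (2 * a / eps ^ 3 * (ct v / om (c u) ^ 2 - 2 * ct (c u) * dom (c u) v / om (c u) ^ 3)
   * / (2 * (1 + Psi q * atan (Psi q))))).
{ apply (is_derive_comp Psi (fun s => 2 * a * ct (c s) / (eps ^ 3 * om (c s) ^ 2)));
    [exact hq |].
  set (w := fun s => om (c s)) in *; set (t := fun s => ct (c s)) in *.
  change (is_derive (fun s => 2 * a * t s / (eps ^ 3 * w s ^ 2)) u
    (2 * a / eps ^ 3 * (ct v / w u ^ 2 - 2 * t u * dom (c u) v / w u ^ 3))).
  change (0 < w u) in op.
  auto_derive.
  - repeat split; try (eexists; eassumption).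
    apply Rgt_not_eq, Rmult_gt_0_compat; [now repeat apply Rmult_gt_0_compat; lra | nra].
  - rewrite_derivatives; field; nonzero. }
evar_last.
- unfold lat; apply (is_derive_mult (fun s => om (c s) / a)
    (fun s => Psi (2 * a * ct (c s) / (eps ^ 3 * om (c s) ^ 2))) u (dom (c u) v / a));
    [| exact e1 | exact Rmult_comm].
  apply is_derive_ext with (fun s => / a * om (c s)); [intro; unfold Rdiv; apply Rmult_comm |].
  unfold Rdiv; rewrite Rmult_comm; now apply is_derive_scal.
- fold q; rewrite eq; unfold plus, mult; simpl; unfold dlat, den in *; fold (ang (c u)).
  rewrite et; unfold Phi; fold (ang (c u)); unfold dom.
  set (w := om (c u)) in *; set (k := lat (c u)) in *; set (A := ang (c u)) in *.
  field; repeat split; try lra; try nra.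
  all: intro h0; apply (Rgt_not_eq _ _ (Rmult_gt_0_compat _ _ op dp)); nra.
Qed.

Definition drad (p v : pt) : R := (cx p * cx v + cy p * cy v + lat p * dlat p v) / rad p.

Definition dnormz (p v : pt) : R := (cx p * cx v + cy p * cy v) / normz p.

Lemma is_derive_rad (c : R -> pt) (u : R) (v : pt) :
  0 < rad2 (c u) -> is_derive c u v -> is_derive (fun s => rad (c s)) u (drad (c u) v).
Proof.
intros hR hc; pose proof (is_derive_lat c u v hc) as hk.
apply is_derive_coordinates in hc; destruct hc as [hx [hy _]].
pose proof (rad_pos _ hR) as hR'.
unfold drad; set (l := dlat _ _) in *; unfold rad, rad2 in *.
set (x := fun s => cx (c s)) in *; set (y := fun s => cy (c s)) in *;
  set (k := fun s => lat (c s)) in *.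
change (is_derive (fun s => sqrt (x s ^ 2 + y s ^ 2 + k s ^ 2)) u
 ((x u * cx v + y u * cy v + k u * l) / sqrt (x u ^ 2 + y u ^ 2 + k u ^ 2))).
change (0 < x u ^ 2 + y u ^ 2 + k u ^ 2) in hR.
change (0 < sqrt (x u ^ 2 + y u ^ 2 + k u ^ 2)) in hR'.
auto_derive.
- repeat split; try (eexists; eassumption); simpl in hR; lra.
- rewrite_derivatives.
  simpl in *; field; lra.
Qed.

Lemma is_derive_normz (c : R -> pt) (u : R) (v : pt) :
  0 < normz (c u) -> is_derive c u v -> is_derive (fun s => normz (c s)) u (dnormz (c u) v).
Proof.
intros hr hc.
apply is_derive_coordinates in hc; destruct hc as [hx [hy _]].
pose proof (normz_sqr (c u)) as hs.
unfold dnormz; unfold normz in *.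
set (x := fun s => cx (c s)) in *; set (y := fun s => cy (c s)) in *.
change (is_derive (fun s => sqrt (x s ^ 2 + y s ^ 2)) u
 ((x u * cx v + y u * cy v) / sqrt (x u ^ 2 + y u ^ 2))).
change (0 < sqrt (x u ^ 2 + y u ^ 2)) in hr.
change (sqrt (x u ^ 2 + y u ^ 2) ^ 2 = x u ^ 2 + y u ^ 2) in hs.
auto_derive.
- repeat split; try (eexists; eassumption); simpl in *; nra.
- rewrite_derivatives.
  simpl in *; field; lra.
Qed.

Lemma is_derive_height (w k : R -> R) (u dw dk : R) :
  0 < w u -> is_derive w u dw -> is_derive k u dk ->
  is_derive (fun s => height (w s) (k s)) u
    (eps ^ 3 * (w u * dk + atan (a * k u / w u) / a * (w u * dw + a ^ 2 * k u * dk))).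
Proof.
intros hw h1 h2; pose proof twist_neq0 as ha.
unfold height; auto_derive.
- repeat split; try (eexists; eassumption); lra.
- rewrite_derivatives; unfold Rsqr.
  replace (a * k u * / w u) with (a * k u / w u) by easy.
  set (A := atan _).
  field; repeat split; first [easy | lra | nra].
Qed.

(** The relation [dt = eps^3 w dk] along a sphere: the terms in [atan] of the differential
    of [height] add up to a multiple of [x dx + y dy + k dk]. *)
Lemma is_derive_from_round (x y k : R -> R) (u dx dy dk : R) :
  is_derive x u dx -> is_derive y u dy -> is_derive k u dk ->
  x u * dx + y u * dy + k u * dk = 0 ->
  is_derive (fun s => from_round (x s) (y s) (k s)) u
    (dx, dy, eps ^ 3 * om (from_round (x u) (y u) (k u)) * dk).
Proof.
intros hx hy hk orth; apply is_derive_coordinates; split; [easy | split; [easy |]].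
set (w := fun s => sqrt (1 + a ^ 2 * (x s ^ 2 + y s ^ 2))).
assert (hw0 : 0 < w u) by (apply sqrt_lt_R0; nra).
assert (hw : is_derive w u (a ^ 2 * (x u * dx + y u * dy) / w u)).
{ unfold w in *; auto_derive.
  - repeat split; try (eexists; eassumption); nra.
  - rewrite_derivatives; simpl in *; field; lra. }
evar_last.
- apply (is_derive_height w k u _ dk hw0 hw hk).
- rewrite om_from_round; fold (w u); rewrite ct_mk.
  replace (k u * dk) with (- (x u * dx + y u * dy)) by lra.
  replace (w u * (a ^ 2 * (x u * dx + y u * dy) / w u) + a ^ 2 * k u * dk)
    with (a ^ 2 * (x u * dx + y u * dy + k u * dk)) by (field; lra).
  rewrite orth; ring.
Qed.

Lemma smooth_om (U : pt -> Prop) : open U -> smooth U om.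
Proof.
intro oU; unfold om; smooth_tac.
intros p _; nra.
Qed.

Lemma smooth_lat (U : pt -> Prop) : open U -> smooth U lat.
Proof.
intro oU; pose proof (smooth_om U oU); unfold lat; smooth_tac.
- intros p _; now apply twist_neq0.
- intros p _; pose proof (om_pos p); apply Rgt_not_eq, Rmult_lt_0_compat; now apply pow_lt.
Qed.

Lemma open_rad2 : open (fun p => 0 < rad2 p).
Proof.
apply (open_comp rad2 (fun r => 0 < r)); [| apply open_gt].
intros p _; apply (Ck_continuous 0 (fun _ => True)); [| easy].
assert (smooth (fun _ => True) rad2); [| auto].
assert (oT : open (fun _ : pt => True)) by apply open_true.
pose proof (smooth_lat _ oT); unfold rad2; smooth_tac.
Qed.

Lemma smooth_rad (U : pt -> Prop) : open U -> (forall p, U p -> 0 < rad2 p) -> smooth U rad.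
Proof.
intros oU h; pose proof (smooth_lat U oU); unfold rad; apply smooth_sqrt; [easy | easy |].
unfold rad2; smooth_tac.
Qed.

(** * The normal and meridian fields in closed form *)

Definition normal (p : pt) : pt :=
  ((cx p + a * lat p * cy p / om p) / (eps * rad p),
   (cy p - a * lat p * cx p / om p) / (eps * rad p),
   eps ^ 2 * lat p * om p / rad p).

(** The unit vector orthogonal to [normal] and to the rotations about the [t]-axis that
    points from the north pole to the south pole. *)
Definition meridian (p : pt) : pt :=
  ((lat p * om p * cx p - a * normz p ^ 2 * cy p) / (eps * rad p * normz p * om p),
   (lat p * om p * cy p + a * normz p ^ 2 * cx p) / (eps * rad p * normz p * om p),
   - (eps ^ 2 * normz p * om p / rad p)).

Definition dnormal (p v : pt) : pt :=
  let dk := dlat p v in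
  let dw := dom p v in
  let dR := drad p v in
  (((cx v + a * (dk * cy p + lat p * cy v) / om p - a * lat p * cy p * dw / om p ^ 2)
    - (cx p + a * lat p * cy p / om p) * dR / rad p) / (eps * rad p),
   ((cy v - a * (dk * cx p + lat p * cx v) / om p + a * lat p * cx p * dw / om p ^ 2)
    - (cy p - a * lat p * cx p / om p) * dR / rad p) / (eps * rad p),
   eps ^ 2 * (dk * om p + lat p * dw - lat p * om p * dR / rad p) / rad p).

Definition dmeridian (p v : pt) : pt :=
  let dk := dlat p v in
  let dw := dom p v in
  let dR := drad p v in
  let dr := dnormz p v in
  let D := dR / rad p + dr / normz p + dw / om p in
  ((dk * om p * cx p + lat p * dw * cx p + lat p * om p * cx v
    - a * (2 * normz p * dr * cy p + normz p ^ 2 * cy v)) / (eps * rad p * normz p * om p)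
    - cx (meridian p) * D,
   (dk * om p * cy p + lat p * dw * cy p + lat p * om p * cy v
    + a * (2 * normz p * dr * cx p + normz p ^ 2 * cx v)) / (eps * rad p * normz p * om p)
    - cy (meridian p) * D,
   - (eps ^ 2 * (dr * om p + normz p * dw - normz p * om p * dR / rad p) / rad p)).

Ltac derive_curve :=
  auto_derive;
  [repeat split; try (eexists; eassumption); try easy;
   repeat (apply Rmult_integral_contrapositive; split); lra
  | rewrite_derivatives; field; repeat split; lra].

Lemma is_derive_normal (c : R -> pt) (u : R) (v : pt) :
  0 < rad2 (c u) -> is_derive c u v -> is_derive (fun s => normal (c s)) u (dnormal (c u) v).
Proof.
intros hR hc.
pose proof (rad_pos _ hR) as pR; pose proof (om_pos (c u)) as pw.
assert (H : forall x y k w r : R -> R, forall dx dy dk dw dr : R,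
  is_derive x u dx -> is_derive y u dy -> is_derive k u dk -> is_derive w u dw ->
  is_derive r u dr -> 0 < w u -> 0 < r u ->
  is_derive (fun s => (x s + a * k s * y s / w s) / (eps * r s)) u
    ((dx + a * (dk * y u + k u * dy) / w u - a * k u * y u * dw / w u ^ 2
      - (x u + a * k u * y u / w u) * dr / r u) / (eps * r u)) /\
  is_derive (fun s => (y s - a * k s * x s / w s) / (eps * r s)) u
    ((dy - a * (dk * x u + k u * dx) / w u + a * k u * x u * dw / w u ^ 2
      - (y u - a * k u * x u / w u) * dr / r u) / (eps * r u)) /\
  is_derive (fun s => eps ^ 2 * k s * w s / r s) u
    (eps ^ 2 * (dk * w u + k u * dw - k u * w u * dr / r u) / r u)).
{ intros x y k w r dx dy dk dw dr h1 h2 h3 h4 h5 h6 h7; split; [| split]; derive_curve. }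
apply is_derive_coordinates.
apply (H (fun s => cx (c s)) (fun s => cy (c s)) (fun s => lat (c s)) (fun s => om (c s))
  (fun s => rad (c s))); try easy; try (now apply is_derive_coordinates in hc).
- now apply is_derive_lat.
- now apply is_derive_om.
- now apply is_derive_rad.
Qed.

Lemma is_derive_meridian (c : R -> pt) (u : R) (v : pt) :
  0 < normz (c u) -> is_derive c u v ->
  is_derive (fun s => meridian (c s)) u (dmeridian (c u) v).
Proof.
intros hr hc.
assert (hR : 0 < rad2 (c u)).
{ unfold rad2; rewrite <- (normz_sqr (c u)); nra. }
pose proof (rad_pos _ hR) as pR; pose proof (om_pos (c u)) as pw.
assert (H : forall x y k w r n : R -> R, forall dx dy dk dw dr dn : R,
  is_derive x u dx -> is_derive y u dy -> is_derive k u dk -> is_derive w u dw ->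
  is_derive r u dr -> is_derive n u dn -> 0 < w u -> 0 < r u -> 0 < n u ->
  is_derive (fun s => (k s * w s * x s - a * n s ^ 2 * y s) / (eps * r s * n s * w s)) u
    ((dk * w u * x u + k u * dw * x u + k u * w u * dx
      - a * (2 * n u * dn * y u + n u ^ 2 * dy)) / (eps * r u * n u * w u)
     - (k u * w u * x u - a * n u ^ 2 * y u) / (eps * r u * n u * w u)
       * (dr / r u + dn / n u + dw / w u)) /\
  is_derive (fun s => (k s * w s * y s + a * n s ^ 2 * x s) / (eps * r s * n s * w s)) u
    ((dk * w u * y u + k u * dw * y u + k u * w u * dy
      + a * (2 * n u * dn * x u + n u ^ 2 * dx)) / (eps * r u * n u * w u)
     - (k u * w u * y u + a * n u ^ 2 * x u) / (eps * r u * n u * w u)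
       * (dr / r u + dn / n u + dw / w u)) /\
  is_derive (fun s => - (eps ^ 2 * n s * w s / r s)) u
    (- (eps ^ 2 * (dn * w u + n u * dw - n u * w u * dr / r u) / r u))).
{ intros x y k w r n dx dy dk dw dr dn h1 h2 h3 h4 h5 h6 h7 h8 h9; split; [| split]; derive_curve. }
apply is_derive_coordinates.
apply (H (fun s => cx (c s)) (fun s => cy (c s)) (fun s => lat (c s)) (fun s => om (c s))
  (fun s => rad (c s)) (fun s => normz (c s))); try easy;
    try (now apply is_derive_coordinates in hc).
- now apply is_derive_lat.
- now apply is_derive_om.
- now apply is_derive_rad.
- now apply is_derive_normz.
Qed.

Lemma field_deriv_normal (p v : pt) :
  0 < rad2 p -> field_deriv normal p v = dnormal p v.
Proof.
intro h; apply field_deriv_eq.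
pose proof (is_derive_normal (fun h : R => plus p (scal h v)) 0 v) as H.
cbv beta in H; rewrite plus_scal_0 in H; apply H; [easy | apply is_derive_line].
Qed.

Lemma field_deriv_meridian (p v : pt) :
  0 < normz p -> field_deriv meridian p v = dmeridian p v.
Proof.
intro h; apply field_deriv_eq.
pose proof (is_derive_meridian (fun h : R => plus p (scal h v)) 0 v) as H.
cbv beta in H; rewrite plus_scal_0 in H; apply H; [easy | apply is_derive_line].
Qed.

Lemma smooth_field_normal (U : pt -> Prop) :
  open U -> (forall p, U p -> 0 < rad2 p) -> smooth_field U normal.
Proof.
intros oU h; pose proof (smooth_lat U oU); pose proof (smooth_om U oU).
pose proof (smooth_rad U oU h).
unfold normal; apply smooth_field_mk; smooth_tac.
all: intros p hp; pose proof (om_pos p); pose proof (rad_pos p (h p hp)); nra.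
Qed.

Lemma smooth_field_scaled_normal (U : pt -> Prop) (h : R) :
  open U -> (forall p, U p -> 0 < rad2 p) ->
  smooth_field U (fun p => scal (- (h / omega eps tau (normz p) ^ 2)) (normal p)).
Proof.
intros oU hU; destruct (smooth_field_normal U oU hU) as [h1 [h2 h3]].
pose proof (smooth_om U oU).
assert (hs : smooth U (fun p => - (h / omega eps tau (normz p) ^ 2))).
{ intro k; apply Ck_ext with (fun p => - (h / om p ^ 2)); [easy | |].
  - intros p _; now rewrite omega_normz.
  - revert k; change (smooth U (fun p => - (h / om p ^ 2))); smooth_tac.
    intros p _; pose proof (om_pos p); apply Rgt_not_eq; now apply pow_lt. }
split; [| split]; [exact (smooth_mult U oU _ _ hs h1) | exact (smooth_mult U oU _ _ hs h2)
  | exact (smooth_mult U oU _ _ hs h3)].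
Qed.

Lemma smooth_field_meridian (U : pt -> Prop) :
  open U -> (forall p, U p -> 0 < normz p) -> smooth_field U meridian.
Proof.
intros oU h; pose proof (smooth_lat U oU); pose proof (smooth_om U oU).
pose proof (smooth_rad U oU (fun p hp => rad2_normz p (h p hp))).
assert (smooth U normz).
{ unfold normz; apply smooth_sqrt; [easy | | smooth_tac].
  intros p hp; rewrite <- normz_sqr; specialize (h p hp); nra. }
unfold meridian; apply smooth_field_mk; smooth_tac.
all: intros p hp; pose proof (om_pos p); specialize (h p hp);
  pose proof (rad_pos p (rad2_normz p h)).
all: repeat (apply Rmult_integral_contrapositive; split); lra.
Qed.

Lemma christoffel_eq (p u v : pt) :
  christoffel eps tau p u v =
  let P := theta eps tau p v * cy u + theta eps tau p u * cy v in
  let Q := theta eps tau p v * cx u + theta eps tau p u * cx v in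
  (- (a / eps ^ 3 * P), a / eps ^ 3 * Q, - (a ^ 2 * (cy p * P + cx p * Q))).
Proof.
unfold christoffel, koszul; rewrite !deriv_along_g by easy.
destruct p as [[p1 p2] p3], u as [[u1 u2] u3], v as [[v1 v2] v3].
unfold theta, X, Y, T, Defs.sigma, twist, cx, cy, ct, plus, scal; simpl.
apply pt_eq; unfold cx, cy, ct; simpl; unfold plus, scal; simpl; unfold mult, plus; simpl;
  field; lra.
Qed.

Lemma g_minus_scal_r (p u v w : pt) (h : R) :
  g p u (minus v (scal h w)) = g p u v - h * g p u w.
Proof.
assert (ec : forall q : pt, cx (opp q) = - cx q /\ cy (opp q) = - cy q /\ ct (opp q) = - ct q) by
  easy.
unfold Defs.g, theta, minus; coords.
destruct (ec (scal h w)) as [-> [-> ->]]; coords; field; lra.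
Qed.

Lemma g_sym (p u v : pt) : g p u v = g p v u.
Proof. unfold Defs.g; field; lra. Qed.

Lemma g_scal_l (p u v : pt) (h : R) : g p (scal h u) v = h * g p u v.
Proof. unfold Defs.g, theta; coords; field; lra. Qed.

Lemma g_definite (p v : pt) : g p v v = 0 -> v = zero.
Proof.
intro h.
assert (he : 0 < / eps ^ 4) by (apply Rinv_0_lt_compat, pow_lt; lra).
assert (e : g p v v = eps ^ 2 * cx v ^ 2 + eps ^ 2 * cy v ^ 2 + / eps ^ 4 * theta eps tau p v ^ 2)
  by (unfold Defs.g; field; lra).
rewrite e in h.
pose proof (Rmult_lt_0_compat _ _ eps_pos eps_pos) as he2.
pose proof (pow2_ge_0 (cx v)); pose proof (pow2_ge_0 (cy v));
  pose proof (pow2_ge_0 (theta eps tau p v)).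
assert (sq : forall r : R, r ^ 2 = 0 -> r = 0) by (intros r hr; nra).
assert (hx : cx v = 0) by (apply sq; nra); assert (hy : cy v = 0) by (apply sq; nra).
assert (ht : theta eps tau p v = 0) by (apply sq; nra).
apply pt_eq; [exact hx | exact hy |].
unfold theta in ht; rewrite hx, hy in ht; change (ct v = 0); lra.
Qed.

Lemma g_normal (p v : pt) :
  0 < rad2 p ->
  g p (normal p) v =
  eps / rad p * (cx p * cx v + cy p * cy v + lat p * ct v / (eps ^ 3 * om p)).
Proof.
intro h; pose proof (rad_pos p h); pose proof (om_pos p).
pose proof (om_sqr p) as hw.
unfold g, theta, normal; rewrite sigma_twist; coords.
set (x := cx p) in *; set (y := cy p) in *; set (k := lat p) in *; set (w := om p) in *;
  set (R := rad p) in *.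
assert (hw' : w ^ 2 = 1 + a ^ 2 * x ^ 2 + a ^ 2 * y ^ 2) by lra.
field [hw']; nonzero.
Qed.

Lemma g_normal_normal (p : pt) : 0 < rad2 p -> g p (normal p) (normal p) = 1.
Proof.
intro h; rewrite g_normal by easy; pose proof (rad_pos p h); pose proof (om_pos p).
pose proof (rad_sqr p) as hR.
unfold normal; coords.
set (x := cx p) in *; set (y := cy p) in *; set (k := lat p) in *; set (w := om p) in *;
  set (R := rad p) in *.
field [hR]; nonzero.
Qed.

(** The three polynomial relations between [x], [y], [k], [w], [R] and [r]; oriented so that
    each rewrites the square of a different variable, they put rational expressions in
    normal form. *)
Ltac abstract_point p :=
  let hr := fresh "hr" in let hw := fresh "hw" in let hk := fresh "hk" in
  assert (hr : cx p ^ 2 = normz p ^ 2 - cy p ^ 2) by (rewrite (normz_sqr p); ring);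
  assert (hw : om p ^ 2 = 1 + a ^ 2 * normz p ^ 2)
    by (rewrite (normz_sqr p); apply om_sqr);
  assert (hk : rad p ^ 2 = normz p ^ 2 + lat p ^ 2)
    by (rewrite (normz_sqr p); apply rad_sqr);
  let x := fresh "x" in let y := fresh "y" in let k := fresh "k" in
  let w := fresh "w" in let Rd := fresh "Rd" in let r := fresh "r" in
  set (x := cx p) in *; set (y := cy p) in *; set (k := lat p) in *; set (w := om p) in *;
  set (Rd := rad p) in *; set (r := normz p) in *.

Lemma g_meridian (p v : pt) :
  0 < normz p ->
  g p (meridian p) v =
  eps * lat p / (rad p * normz p) * (cx p * cx v + cy p * cy v)
  - normz p / (eps ^ 2 * rad p * om p) * ct v.
Proof.
intro h; pose proof (rad_pos p (rad2_normz p h)); pose proof (om_pos p).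
unfold g, theta, meridian; rewrite sigma_twist; coords.
abstract_point p.
field [hr hw hk]; nonzero.
Qed.

Lemma g_normal_meridian (p : pt) : 0 < normz p -> g p (normal p) (meridian p) = 0.
Proof.
intro h; pose proof (rad2_normz p h) as h'; rewrite g_normal by easy.
pose proof (rad_pos p h'); pose proof (om_pos p).
unfold meridian; coords.
abstract_point p.
field [hr hw hk]; nonzero.
Qed.

Lemma g_meridian_meridian (p : pt) : 0 < normz p -> g p (meridian p) (meridian p) = 1.
Proof.
intro h; pose proof (rad2_normz p h) as h'; rewrite g_meridian by easy.
pose proof (rad_pos p h'); pose proof (om_pos p).
unfold meridian; coords.
abstract_point p.
field [hr hw hk]; nonzero.
Qed.

Lemma dom_dnormz (p v : pt) :
  0 < normz p -> dom p v = a ^ 2 * normz p * dnormz p v / om p.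
Proof.
intro h; pose proof (om_pos p).
unfold dnormz, dom; field; nonzero.
Qed.

Lemma dlat_dnormz (p v : pt) :
  0 < normz p ->
  dlat p v =
  (ct v / eps ^ 3 - a * ang p * (normz p * dnormz p v)) / den p.
Proof.
intro h; pose proof (den_pos p).
unfold dnormz, dlat; field; nonzero.
Qed.

Lemma drad_dnormz (p v : pt) :
  0 < normz p ->
  drad p v = (normz p * dnormz p v + lat p * dlat p v) / rad p.
Proof.
intro h; pose proof (rad_pos p (rad2_normz p h)).
unfold dnormz, drad; field; nonzero.
Qed.

Lemma dnormz_meridian (p : pt) :
  0 < normz p -> dnormz p (meridian p) = lat p / (eps * rad p).
Proof.
intro h; pose proof (rad_pos p (rad2_normz p h)); pose proof (om_pos p).
unfold dnormz, meridian; coords.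
abstract_point p.
field [hr hw hk]; nonzero.
Qed.

(** Together with [dnormz_meridian]: along [meridian] the point [(normz, lat)] turns
    at the angular speed [1 / (eps * rad)]. *)
Lemma dlat_meridian (p : pt) :
  0 < normz p -> dlat p (meridian p) = - (normz p / (eps * rad p)).
Proof.
intro h; pose proof (rad_pos p (rad2_normz p h)); pose proof (om_pos p).
pose proof (den_pos p) as hd.
rewrite dlat_dnormz, dnormz_meridian by easy; unfold meridian; coords.
unfold den in *; field; nonzero.
Qed.

Lemma drad_meridian (p : pt) : 0 < normz p -> drad p (meridian p) = 0.
Proof.
intro h; pose proof (rad_pos p (rad2_normz p h)).
rewrite drad_dnormz, dlat_meridian, dnormz_meridian by easy; field; nonzero.
Qed.

(** All derivatives along [meridian] of the functions that occur in it are algebraic, the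
    [atan] terms having cancelled in [dlat_meridian]; what remains is a rational identity. *)
Lemma nabla_meridian_meridian (p : pt) :
  0 < normz p ->
  nabla eps tau meridian meridian p =
  scal (- (1 / (eps * rad p * om p ^ 2))) (normal p).
Proof.
intro h; pose proof (rad_pos p (rad2_normz p h)); pose proof (om_pos p).
unfold nabla; rewrite field_deriv_meridian, christoffel_eq by easy.
unfold dmeridian; rewrite drad_meridian, dom_dnormz, dlat_meridian, dnormz_meridian by easy.
unfold theta, meridian, normal; rewrite sigma_twist; cbv zeta.
abstract_point p.
apply pt_eq; coords; field [hr hw hk]; nonzero.
Qed.

Lemma dnormz_normal (p : pt) : 0 < normz p -> dnormz p (normal p) = normz p / (eps * rad p).
Proof.
intro h; pose proof (rad_pos p (rad2_normz p h)); pose proof (om_pos p).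
unfold dnormz, normal; coords.
abstract_point p.
field [hr hw hk]; nonzero.
Qed.

Lemma dlat_normal (p : pt) :
  0 < normz p ->
  dlat p (normal p) =
  (lat p * om p - a * ang p * normz p ^ 2) / (eps * rad p * den p).
Proof.
intro h; pose proof (rad_pos p (rad2_normz p h)); pose proof (om_pos p).
pose proof (den_pos p) as hd.
rewrite dlat_dnormz, dnormz_normal by easy; unfold normal; coords.
field; nonzero.
Qed.

Lemma drad_normal (p : pt) :
  0 < normz p -> drad p (normal p) = om p / (eps * den p).
Proof.
intro h; pose proof (rad_pos p (rad2_normz p h)).
pose proof (den_pos p) as hd.
rewrite drad_dnormz, dlat_normal, dnormz_normal by easy.
unfold den in *; set (A := ang _) in *.
abstract_point p.
field [hr hw hk]; nonzero.
Qed.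

(** Both sides are the tangential gradient of the logarithm of [|grad rad|].  The factor
    [ct p] arises because differentiating [den / om] produces the expression
    [(w^2 + a^2 k^2) atan (a k / w) + a k w] of [height], so that the coefficient has the
    sign of [ct p]. *)
Lemma nabla_normal_normal (p : pt) :
  0 < normz p ->
  nabla eps tau normal normal p =
  scal (2 * a ^ 2 * normz p * ct p / (eps ^ 4 * rad p * om p ^ 2 * den p)) (meridian p).
Proof.
intro h; pose proof (rad_pos p (rad2_normz p h)); pose proof (om_pos p).
pose proof (den_pos p) as hd; pose proof twist_neq0 as ha.
assert (ht : ct p = eps ^ 3 / (2 * a) *
  ((om p ^ 2 + a ^ 2 * lat p ^ 2) * ang p + a * lat p * om p))
  by (symmetry; apply height_lat; easy).
unfold nabla; rewrite field_deriv_normal, christoffel_eq by (try apply rad2_normz; easy).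
unfold dnormal; rewrite drad_normal, dom_dnormz, dlat_normal, dnormz_normal by easy.
rewrite ht; unfold theta, meridian, normal; rewrite sigma_twist; cbv zeta.
unfold den in *; set (A := ang _) in *; clear ht.
abstract_point p.
apply pt_eq; coords; field [hr hw hk]; nonzero.
Qed.

(** * The hypotheses determine both fields *)

(** In round coordinates the velocity is a vector [Q] orthogonal to the position [P], and the
    curve is [P + h Q] rescaled to radius [Rad].  Poles and equator are ordinary
    points in these coordinates. *)
Lemma tangent_of_orthogonal (Rad : R) (p v : pt) :
  0 < Rad -> sphere eps tau Rad p -> g p (normal p) v = 0 ->
  tangent_vector (sphere eps tau Rad) p v.
Proof.
intros hR hp hv.
pose proof (rad2_sphere Rad p hR hp) as h0; pose proof (rad_pos p h0) as h1.
pose proof (om_pos p) as hw.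
rewrite g_normal in hv by easy.
(* [l] is the component of the velocity along [lat], from [dt = eps^3 w dk]. *)
set (l := ct v / (eps ^ 3 * om p)).
assert (he : 0 < eps / rad p) by (apply Rdiv_lt_0_compat; lra).
assert (orth : cx p * cx v + cy p * cy v + lat p * l = 0).
{ apply Rmult_integral in hv; destruct hv as [hv | hv]; [lra |].
  rewrite <- hv; unfold l; field; nonzero. }
assert (hs : cx p ^ 2 + cy p ^ 2 + lat p ^ 2 = Rad ^ 2) by now apply sphere_iff in hp.
set (q := cx v ^ 2 + cy v ^ 2 + l ^ 2).
assert (hq : 0 <= q) by (unfold q; nra).
set (S := fun h => Rad / sqrt (Rad ^ 2 + h ^ 2 * q)).
assert (hden : forall h, 0 < Rad ^ 2 + h ^ 2 * q) by (intro h; pose proof (pow2_ge_0 h); nra).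
assert (S0 : S 0 = 1).
{ unfold S; replace (Rad ^ 2 + 0 ^ 2 * q) with (Rad ^ 2) by ring.
  rewrite sqrt_pow2 by lra; field; lra. }
assert (dS : forall m n : R, is_derive (fun h => (m + h * n) * S h) 0 n).
{ intros m n; cut (is_derive (fun h => (m + h * n) * S h) 0 (n * S 0));
    [now rewrite S0, Rmult_1_r |].
  pose proof (hden 0) as hd; pose proof (sqrt_lt_R0 _ hd) as hd'; unfold S in *.
  auto_derive.
  - simpl in *; repeat split; try easy; lra.
  - simpl in *; field; lra. }
exists (fun h => from_round ((cx p + h * cx v) * S h) ((cy p + h * cy v) * S h)
  ((lat p + h * l) * S h)).
split; [| split].
- rewrite S0, !Rmult_0_l, !Rplus_0_r, !Rmult_1_r; apply from_round_lat.
- apply filter_forall; intro h; apply sphere_iff; try easy.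
  rewrite rad2_from_round.
  replace (((cx p + h * cx v) * S h) ^ 2 + ((cy p + h * cy v) * S h) ^ 2 + ((lat p + h * l) * S
    h) ^ 2)
    with ((cx p ^ 2 + cy p ^ 2 + lat p ^ 2 + 2 * h * (cx p * cx v + cy p * cy v + lat p * l)
      + h ^ 2 * q) * S h ^ 2) by (unfold q; ring).
  rewrite orth, hs, Rmult_0_r, Rplus_0_r.
  unfold S; pose proof (sqrt_lt_R0 _ (hden h)) as hd.
  unfold Rdiv; rewrite Rpow_mult_distr, pow_inv, pow2_sqrt by (apply Rlt_le, hden).
  field; pose proof (hden h); lra.
- pose proof (is_derive_from_round _ _ _ 0 _ _ _ (dS (cx p) (cx v)) (dS (cy p) (cy v)) (dS (lat
    p) l)) as H.
  cbv beta in H; rewrite S0, !Rmult_0_l, !Rplus_0_r, !Rmult_1_r, from_round_lat in H.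
  replace v with (cx v, cy v, eps ^ 3 * om p * l); [now apply H |].
  apply pt_eq; try easy; rewrite ct_mk; unfold l; field; nonzero.
Qed.

(** Exhibits [normal] as the normalised gradient of [rad], and [om / (eps * den)] as the length
    of that gradient. *)
Lemma drad_eq (p v : pt) :
  0 < rad2 p -> drad p v = om p / (eps * den p) * g p (normal p) v.
Proof.
intro h; rewrite g_normal by easy.
pose proof (rad_pos p h); pose proof (om_pos p).
pose proof (den_pos p) as hd.
unfold drad, dlat; unfold den in *; field; nonzero.
Qed.

(** A vector orthogonal to everything orthogonal to [normal] is proportional to it, which
    leaves a sign; the sign is decided by the fact that [rad] increases along [normal]. *)
Lemma exterior_unit_normal_unique (Rad : R) (p n : pt) :
  0 < Rad -> sphere eps tau Rad p -> exterior_unit_normal eps tau Rad p n -> n = normal p.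
Proof.
intros hR hp [h1 [h2 h3]].
pose proof (rad2_sphere Rad p hR hp) as h0.
set (s := g p (normal p) n).
pose proof (g_normal_normal p h0) as hN.
assert (hw : g p (normal p) (minus n (scal s (normal p))) = 0)
  by (rewrite g_minus_scal_r, hN; unfold s; ring).
assert (ew : minus n (scal s (normal p)) = zero).
{ apply (g_definite p).
  rewrite g_minus_scal_r, (g_sym p _ n), (g_sym p _ (normal p)), hw, h2; [ring |].
  now apply tangent_of_orthogonal. }
assert (en : n = scal s (normal p)).
{ pose proof (f_equal cx ew) as e1; pose proof (f_equal cy ew) as e2;
    pose proof (f_equal ct ew) as e3.
  change (cx n + - cx (scal s (normal p)) = 0) in e1.
  change (cy n + - cy (scal s (normal p)) = 0) in e2.
  change (ct n + - ct (scal s (normal p)) = 0) in e3.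
  apply pt_eq; lra. }
assert (hs : s * s = 1).
{ rewrite en, g_scal_l, g_sym, g_scal_l, hN in h1; lra. }
assert (s = 1 \/ s = - 1) as [-> | e] by (destruct (Rle_or_lt 0 s); [left | right]; nra).
{ rewrite en; exact (scal_one (normal p)). }
(* The inward normal is excluded: [rad] decreases along it, so points just beyond [p]
   lie in the ball. *)
exfalso.
pose proof (om_pos p) as pw; pose proof (den_pos p) as pd.
pose proof (is_derive_rad (fun h : R => plus p (scal h n)) 0 n) as hd.
cbv beta in hd; rewrite plus_scal_0 in hd; specialize (hd h0 (is_derive_line p n)).
rewrite drad_eq in hd by easy; fold s in hd; rewrite e in hd.
destruct (fun hl => descends_right _ _ _ hd hl h3) as [h [hb hlt]].
- assert (0 < om p / (eps * den p)) by (apply Rdiv_lt_0_compat; nra); lra.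
- apply hb, ball_iff; try easy.
  rewrite plus_scal_0, (sphere_rad Rad p) in hlt by easy.
  pose proof (rad_sqr (plus p (scal h n))) as hr.
  unfold rad2; rewrite <- hr.
  assert (0 <= rad (plus p (scal h n))) by apply sqrt_pos.
  nra.
Qed.

Lemma normal_field_eq (NN : pt -> pt) (p : pt) :
  is_normal_field eps tau NN -> 0 < rad2 p -> NN p = normal p.
Proof.
intros hN h; pose proof (rad_pos p h) as hr.
pose proof (on_own_sphere p h) as hp.
apply (exterior_unit_normal_unique (rad p)); auto.
Qed.

Lemma nabla_ext (U : pt -> Prop) (V V' W W' : pt -> pt) (p : pt) :
  open U -> U p -> (forall q, U q -> V q = V' q) -> (forall q, U q -> W q = W' q) ->
  nabla eps tau V W p = nabla eps tau V' W' p.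
Proof.
intros oU hp eV eW; unfold nabla; rewrite eV, eW by easy; f_equal.
unfold field_deriv; f_equal; [f_equal |]; apply deriv_along_ext with U; try easy;
  intros q hq; now rewrite eW.
Qed.

Variable NN : pt -> pt.
Hypothesis NN_normal : is_normal_field eps tau NN.

Lemma nabla_NN (V : pt -> pt) (p : pt) : 0 < rad2 p -> nabla eps tau V NN p = nabla eps tau V
  normal p.
Proof.
intro h; apply nabla_ext with (fun q => 0 < rad2 q); try easy.
- now apply open_rad2.
- intros q hq; now apply normal_field_eq.
Qed.

Lemma nabla_NN_NN (p : pt) :
  0 < normz p ->
  nabla eps tau NN NN p =
  scal (2 * a ^ 2 * normz p * ct p / (eps ^ 4 * rad p * om p ^ 2 * den p)) (meridian p).
Proof.
intro h; rewrite <- nabla_normal_normal by easy.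
apply nabla_ext with (fun q => 0 < rad2 q).
- now apply open_rad2.
- now apply rad2_normz.
- intros q hq; now apply normal_field_eq.
- intros q hq; now apply normal_field_eq.
Qed.

Lemma tangential_normal (p : pt) (h : R) : 0 < rad2 p -> tangential eps tau NN p (scal h (normal
  p)) = zero.
Proof.
intro hp; unfold tangential.
rewrite (normal_field_eq NN p NN_normal hp).
rewrite g_scal_l, g_normal_normal, Rmult_1_r by easy.
apply (plus_opp_r (scal h (normal p))).
Qed.

Variable MM : pt -> pt.
Hypothesis MM_meridian : is_meridian_field eps tau NN MM.

Lemma meridian_field_off_equator (p : pt) : 0 < normz p -> ct p <> 0 -> MM p = meridian p.
Proof.
intros h ht; pose proof (rad2_normz p h) as h2; pose proof (rad_pos p h2) as h3.
destruct (MM_meridian (rad p) h3) as [hM _].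
specialize (hM p); cbv zeta in hM; rewrite hM; [| | easy].
2 : { apply sphere_star_iff; [easy | split; [now apply on_own_sphere | easy]]. }
rewrite nabla_NN_NN by easy.
rewrite g_scal_l, g_sym, g_scal_l, g_meridian_meridian, Rmult_1_r by easy.
pose proof (om_pos p) as hw; pose proof (den_pos p) as hd.
pose proof twist_neq0 as ha.
set (C := 2 * a ^ 2 * normz p / (eps ^ 4 * rad p * om p ^ 2 * den p)).
assert (hC : 0 < C).
{ unfold C; assert (0 < a ^ 2) by (rewrite <- Rsqr_pow2; now apply Rsqr_pos_lt).
  assert (0 < eps ^ 4) by (now apply pow_lt).
  apply Rdiv_lt_0_compat; repeat first [assumption | lra | now apply pow_lt | apply
    Rmult_lt_0_compat]. }
replace (2 * a ^ 2 * normz p * ct p / (eps ^ 4 * rad p * om p ^ 2 * den p)) with (C * ct p)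
  by (unfold C; field; nonzero).
change (C * ct p * (C * ct p)) with (Rsqr (C * ct p)); rewrite sqrt_Rsqr_abs.
apply pt_eq; coords; rewrite <- (Rmult_1_l (_ (meridian p))) at 2; rewrite <- !Rmult_assoc; f_equal.
all: destruct (Rtotal_order (ct p) 0) as [hlt | [heq | hgt]]; [| easy |].
all: first [rewrite sign_eq_m1, Rabs_left by nra | rewrite sign_eq_1, Rabs_pos_eq by nra];
  field; split; lra.
Qed.

(** At a point of the equator the field is the value of its smooth extension, hence the limit
    along the great circle of the round sphere that leaves the equator at a right angle. *)
Lemma meridian_field_eq (p : pt) : 0 < normz p -> MM p = meridian p.
Proof.
intro h; destruct (Req_dec (ct p) 0) as [ht | ht]; [| now apply meridian_field_off_equator].
pose proof (rad2_normz p h) as h2; pose proof (rad_pos p h2) as h3.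
set (r := normz p) in *.
assert (hk : lat p = 0) by (apply lat_unique; try easy; now rewrite height_0).
assert (hs : cx p ^ 2 + cy p ^ 2 = r ^ 2) by (symmetry; apply normz_sqr).
set (c := fun h => from_round (cx p * cos h) (cy p * cos h) (r * sin h)).
assert (c0 : c 0 = p).
{ unfold c; rewrite cos_0, sin_0, Rmult_0_r, !Rmult_1_r, <- hk; now apply from_round_lat. }
assert (hc : forall u, is_derive c u (cx p * - sin u, cy p * - sin u,
  eps ^ 3 * om (c u) * (r * cos u))).
{ intro u; apply (is_derive_from_round
    (fun h => cx p * cos h) (fun h => cy p * cos h) (fun h => r * sin h)).
  1-3: auto_derive; [easy | ring].
  transitivity ((r ^ 2 - (cx p ^ 2 + cy p ^ 2)) * (cos u * sin u)); [ring |].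
  rewrite hs; ring. }
assert (cc : forall u, continuous c u) by (intro u; eapply curve_continuous, hc).
assert (hp : sphere_star eps tau r p).
{ apply sphere_star_iff; [easy | split; [| easy]].
  apply sphere_iff; try easy; unfold rad2; rewrite hk; lra. }
destruct (MM_meridian r h) as [_ hsm].
destruct (hsm p hp) as [U [F [oU [Up [hF eF]]]]].
assert (near : at_right 0 (fun u => F (c u) = meridian (c u))).
{ assert (n1 : locally 0 (fun u => U (c u))) by (apply (cc 0 U); rewrite c0; now apply oU).
  assert (n2 : locally 0 (fun u => 0 < normz (c u)))
    by (apply (cc 0 (fun q => 0 < normz q)); rewrite c0; now apply open_normz).
  destruct n1 as [d1 n1], n2 as [d2 n2].
  assert (hd : 0 < Rmin (Rmin d1 d2) PI)
    by (repeat apply Rmin_pos; try apply cond_pos; apply PI_RGT_0).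
  exists (mkposreal _ hd); intros u hu upos.
  assert (hu' : u < Rmin (Rmin d1 d2) PI).
  { change (Rabs (u + - 0) < Rmin (Rmin d1 d2) PI) in hu.
    rewrite Rabs_pos_eq in hu; lra. }
  pose proof (Rmin_l (Rmin d1 d2) PI); pose proof (Rmin_r (Rmin d1 d2) PI).
  pose proof (Rmin_l d1 d2); pose proof (Rmin_r d1 d2).
  assert (b : forall d : posreal, u < d -> ball 0 d u).
  { intros d hd'; change (Rabs (u + - 0) < d); rewrite Rabs_pos_eq; lra. }
  specialize (n1 u (b d1 ltac:(lra))); specialize (n2 u (b d2 ltac:(lra))).
  assert (hlat : lat (c u) = r * sin u) by (unfold c; now apply lat_from_round).
  assert (sin u > 0) by (apply sin_gt_0; lra).
  rewrite eF; [| | exact n1].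
  - apply meridian_field_off_equator; [easy |].
    intro e; assert (e' : lat (c u) = 0) by (apply lat_unique; try easy; now rewrite height_0).
    rewrite hlat in e'; nra.
  - apply sphere_star_iff; [easy | split; [| easy]].
    apply sphere_iff; try easy; unfold c; rewrite rad2_from_round by easy.
    transitivity ((cx p ^ 2 + cy p ^ 2) * cos u ^ 2 + r ^ 2 * sin u ^ 2); [ring |].
    rewrite hs; pose proof (sin2_cos2 u) as e; unfold Rsqr in e.
    transitivity (r ^ 2 * (sin u * sin u + cos u * cos u)); [ring | rewrite e; ring]. }
assert (hM : smooth_field (fun q => 0 < normz q) meridian)
  by (apply smooth_field_meridian; try easy; apply open_normz).
destruct hF as [F1 [F2 F3]], hM as [M1 [M2 M3]].
rewrite <- (eF p hp Up), <- c0.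
assert (hr : 0 < normz (c 0)) by (now rewrite c0); rewrite <- c0 in Up.
apply pt_eq.
- apply (eq_along_curve (fun q => cx (F q)) (fun q => cx (meridian q)) c (cc 0)
    (Ck_continuous _ _ _ _ (F1 0%nat) Up) (Ck_continuous _ _ _ _ (M1 0%nat) hr)).
  apply filter_imp with (2 := near); now intros ? ->.
- apply (eq_along_curve (fun q => cy (F q)) (fun q => cy (meridian q)) c (cc 0)
    (Ck_continuous _ _ _ _ (F2 0%nat) Up) (Ck_continuous _ _ _ _ (M2 0%nat) hr)).
  apply filter_imp with (2 := near); now intros ? ->.
- apply (eq_along_curve (fun q => ct (F q)) (fun q => ct (meridian q)) c (cc 0)
    (Ck_continuous _ _ _ _ (F3 0%nat) Up) (Ck_continuous _ _ _ _ (M3 0%nat) hr)).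
  apply filter_imp with (2 := near); now intros ? ->.
Qed.

Lemma nabla_MM_MM (p : pt) :
  0 < normz p ->
  nabla eps tau MM MM p = scal (- (1 / (eps * rad p * om p ^ 2))) (normal p).
Proof.
intro h; rewrite <- nabla_meridian_meridian by easy.
apply nabla_ext with (fun q => 0 < normz q); try easy.
- apply open_normz.
- intros q hq; now apply meridian_field_eq.
- intros q hq; now apply meridian_field_eq.
Qed.

(** * Mean curvature *)

(** The unit tangent vector of the circle of latitude through [p]. *)
Definition parallel (p : pt) : pt :=
  (- (cy p / (eps * normz p * om p)), cx p / (eps * normz p * om p), 0).

Lemma mean_curvature_off_poles (Rad : R) (p : pt) :
  0 < Rad -> sphere eps tau Rad p -> 0 < normz p ->
  mean_curvature_at eps tau NN Rad p (1 / (eps * Rad)).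
Proof.
intros hR hp h; pose proof (rad2_normz p h) as h2; pose proof (rad_pos p h2) as h3.
pose proof (om_pos p) as pw; pose proof (den_pos p) as pd.
rewrite <- (sphere_rad Rad p hR hp).
assert (d0 : dnormz p (parallel p) = 0)
  by (unfold dnormz, parallel; coords; field; nonzero).
exists (meridian p), (parallel p); repeat apply conj.
- rewrite (sphere_rad Rad p hR hp).
  apply tangent_of_orthogonal; try easy; now apply g_normal_meridian.
- rewrite (sphere_rad Rad p hR hp).
  apply tangent_of_orthogonal; try easy; rewrite g_normal by easy.
  unfold parallel; coords; field; nonzero.
- now apply g_meridian_meridian.
- unfold Defs.g, theta, parallel; rewrite sigma_twist; coords.
  abstract_point p; field [hr hw hk]; nonzero.
- rewrite g_meridian by easy; unfold parallel; coords; field; nonzero.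
- pose proof nabla_NN as eN.
  rewrite !eN by easy; unfold nabla.
  rewrite !field_deriv_normal, !christoffel_eq by easy; unfold dnormal.
  rewrite !drad_dnormz, !dom_dnormz, dlat_meridian, dlat_dnormz,
    dnormz_meridian, d0 by easy.
  rewrite g_sym, g_meridian by easy.
  unfold Defs.g, theta, parallel, meridian, normal; rewrite sigma_twist; cbv zeta.
  coords.
  unfold den in *; set (A := ang _) in *.
  abstract_point p; field [hr hw hk]; nonzero.
Qed.

(** [meridian] has no limit at the poles; there the horizontal frame is tangent to the
    sphere and serves as the basis. *)
Lemma mean_curvature_pole (Rad : R) (p : pt) :
  0 < Rad -> sphere eps tau Rad p -> normz p = 0 ->
  mean_curvature_at eps tau NN Rad p (1 / (eps * Rad)).
Proof.
intros hR hp h; apply normz_eq_0 in h; destruct h as [hx hy].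
pose proof (rad2_sphere Rad p hR hp) as h2.
pose proof (rad_pos p h2) as h3.
pose proof (den_pos p) as pd.
assert (hw : om p = 1).
{ unfold om; rewrite hx, hy; transitivity (sqrt 1); [f_equal; ring | apply sqrt_1]. }
pose proof (sphere_rad Rad p hR hp) as er; rewrite <- er.
destruct (g_orthonormal eps tau eps_pos p) as [gX [gY [_ [gXY _]]]].
exists (X eps tau p), (Y eps tau p); repeat apply conj; try easy.
- rewrite er; apply tangent_of_orthogonal; try easy.
  rewrite g_normal, hx, hy by easy; unfold X; coords; rewrite hy; field; nonzero.
- rewrite er; apply tangent_of_orthogonal; try easy.
  rewrite g_normal, hx, hy by easy; unfold Y; coords; rewrite hx; field; nonzero.
- pose proof nabla_NN as eN.
  rewrite !eN by easy; unfold nabla.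
  rewrite !field_deriv_normal, !christoffel_eq by easy.
  unfold dnormal, drad, dlat, dom, Defs.g, theta, X, Y, normal.
  rewrite sigma_twist; cbv zeta; coords; rewrite hx, hy, hw.
  field; nonzero.
Qed.

Lemma mean_curvature (Rad : R) (p : pt) :
  0 < Rad -> sphere eps tau Rad p -> mean_curvature_at eps tau NN Rad p (1 / (eps * Rad)).
Proof.
intros hR hp; destruct (normz_nonneg p) as [h | h].
- now apply mean_curvature_off_poles.
- now apply mean_curvature_pole.
Qed.

(** * Integral curves *)

Variable Rad : R.
Hypothesis Rad_pos : 0 < Rad.

Definition equator_om : R := sqrt (1 + a ^ 2 * Rad ^ 2).

Lemma equator_om_sqr : equator_om ^ 2 = 1 + a ^ 2 * Rad ^ 2.
Proof. apply pow2_sqrt; nra. Qed.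

Lemma equator_om_pos : 0 < equator_om.
Proof. apply sqrt_lt_R0; nra. Qed.

Definition arc_om (phi : R) : R := sqrt (1 + a ^ 2 * (Rad * sin phi) ^ 2).

Lemma arc_om_sqr (phi : R) : arc_om phi ^ 2 = 1 + a ^ 2 * (Rad * sin phi) ^ 2.
Proof. apply pow2_sqrt; nra. Qed.

Lemma arc_om_pos (phi : R) : 0 < arc_om phi.
Proof. apply sqrt_lt_R0; nra. Qed.

Definition arc_x (e1 e2 phi : R) : R :=
  Rad * sin phi * (e1 * arc_om phi + e2 * (a * (Rad * cos phi))) / equator_om.

Definition arc_y (e1 e2 phi : R) : R :=
  Rad * sin phi * (e2 * arc_om phi - e1 * (a * (Rad * cos phi))) / equator_om.

(** Written with complex numbers, [z = e r (w - i a k) / omega Rad] for a unit number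
    [e = e1 + i e2], where [r = Rad sin phi] and [k = Rad cos phi].  The rotation by the
    argument of [w - i a k] is the integral of the angular part of [meridian].  The formula
    is smooth through the poles [phi = 0] and [phi = PI]. *)
Definition arc (e1 e2 phi : R) : pt :=
  from_round (arc_x e1 e2 phi) (arc_y e1 e2 phi) (Rad * cos phi).

Lemma sin_sqr (phi : R) : sin phi ^ 2 = 1 - cos phi ^ 2.
Proof. pose proof (sin2_cos2 phi) as h; unfold Rsqr in h; lra. Qed.

Lemma arc_norm (e1 e2 phi : R) :
  e1 ^ 2 + e2 ^ 2 = 1 -> arc_x e1 e2 phi ^ 2 + arc_y e1 e2 phi ^ 2 = (Rad * sin phi) ^ 2.
Proof.
intro he; unfold arc_x, arc_y.
pose proof equator_om_sqr as h1; pose proof equator_om_pos as h2.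
pose proof (arc_om_sqr phi) as h3; pose proof (sin_sqr phi) as h4.
assert (he' : e1 ^ 2 = 1 - e2 ^ 2) by lra.
set (w := arc_om phi) in *; set (v := equator_om) in *; set (s := sin phi) in *;
  set (k := cos phi) in *.
assert (h5 : w ^ 2 = v ^ 2 - a ^ 2 * Rad ^ 2 * k ^ 2) by (rewrite h1, h3, Rpow_mult_distr, h4;
  ring).
clear h1 h3 h4.
field [he' h5]; lra.
Qed.

Lemma arc_sphere (e1 e2 phi : R) : e1 ^ 2 + e2 ^ 2 = 1 -> sphere eps tau Rad (arc e1 e2 phi).
Proof.
intro he; apply sphere_iff; try easy; unfold arc; rewrite rad2_from_round, arc_norm by easy.
rewrite !Rpow_mult_distr, sin_sqr; ring.
Qed.

Lemma om_arc (e1 e2 phi : R) : e1 ^ 2 + e2 ^ 2 = 1 -> om (arc e1 e2 phi) = arc_om phi.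
Proof. intro he; unfold arc; now rewrite om_from_round, arc_norm. Qed.

Lemma lat_arc (e1 e2 phi : R) : lat (arc e1 e2 phi) = Rad * cos phi.
Proof. now apply lat_from_round. Qed.

Lemma normz_arc (e1 e2 phi : R) :
  e1 ^ 2 + e2 ^ 2 = 1 -> 0 <= sin phi -> normz (arc e1 e2 phi) = Rad * sin phi.
Proof.
intros he hs; unfold normz, arc, from_round; coords; rewrite arc_norm by easy.
apply sqrt_pow2; nra.
Qed.

Lemma is_derive_arc_om (phi : R) :
  is_derive arc_om phi (a ^ 2 * (Rad * sin phi) * (Rad * cos phi) / arc_om phi).
Proof.
pose proof (arc_om_pos phi) as h; unfold arc_om in *; auto_derive.
- simpl in *; repeat split; try easy; nra.
- simpl in *; field; lra.
Qed.

Lemma is_derive_arc (e1 e2 phi : R) :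
  e1 ^ 2 + e2 ^ 2 = 1 ->
  exists v, is_derive (arc e1 e2) phi v /\
    (0 < sin phi -> v = scal (eps * Rad) (meridian (arc e1 e2 phi))).
Proof.
intro he.
pose proof (is_derive_arc_om phi) as hw.
pose proof equator_om_sqr as h1; pose proof equator_om_pos as h2.
pose proof (arc_om_sqr phi) as h3; pose proof (arc_om_pos phi) as h6;
  pose proof (sin_sqr phi) as h4.
assert (he' : e1 ^ 2 = 1 - e2 ^ 2) by lra.
set (dw := a ^ 2 * (Rad * sin phi) * (Rad * cos phi) / arc_om phi) in *.
set (dx := (Rad * cos phi * (e1 * arc_om phi + e2 * (a * (Rad * cos phi)))
  + Rad * sin phi * (e1 * dw - e2 * (a * (Rad * sin phi)))) / equator_om).
set (dy := (Rad * cos phi * (e2 * arc_om phi - e1 * (a * (Rad * cos phi)))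
  + Rad * sin phi * (e2 * dw + e1 * (a * (Rad * sin phi)))) / equator_om).
assert (hx : is_derive (arc_x e1 e2) phi dx).
{ unfold arc_x, dx; auto_derive; [repeat split; try (eexists; eassumption); lra |].
  rewrite_derivatives; field; lra. }
assert (hy : is_derive (arc_y e1 e2) phi dy).
{ unfold arc_y, dy; auto_derive; [repeat split; try (eexists; eassumption); lra |].
  rewrite_derivatives; field; lra. }
assert (hk : is_derive (fun s => Rad * cos s) phi (- (Rad * sin phi)))
  by (auto_derive; [easy | ring]).
assert (h5 : arc_om phi ^ 2 = 1 + a ^ 2 * Rad ^ 2 - a ^ 2 * Rad ^ 2 * cos phi ^ 2)
  by (rewrite h3, Rpow_mult_distr, h4; ring).
exists (dx, dy, eps ^ 3 * om (arc e1 e2 phi) * - (Rad * sin phi)); split.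
- apply (is_derive_from_round _ _ _ _ _ _ _ hx hy hk).
  unfold dx, dy, arc_x, arc_y, dw.
  set (w := arc_om phi) in *; set (v := equator_om) in *; set (s := sin phi) in *;
    set (k := cos phi) in *.
  field [he' h1 h4 h5]; nonzero.
- intro hs; unfold meridian; rewrite om_arc, lat_arc, normz_arc by (try easy; lra).
  rewrite (sphere_rad Rad) by (try easy; now apply arc_sphere).
  assert (c1 : cx (arc e1 e2 phi) = arc_x e1 e2 phi) by easy.
  assert (c2 : cy (arc e1 e2 phi) = arc_y e1 e2 phi) by easy.
  rewrite c1, c2; unfold dx, dy, arc_x, arc_y, dw.
  set (w := arc_om phi) in *; set (v := equator_om) in *; set (s := sin phi) in *;
    set (k := cos phi) in *.
  apply pt_eq; coords.
  + field [he' h1 h4 h5]; nonzero.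
  + field [he' h1 h4 h5]; nonzero.
  + field; nonzero.
Qed.

Lemma arc_continuous (e1 e2 phi : R) : e1 ^ 2 + e2 ^ 2 = 1 -> continuous (arc e1 e2) phi.
Proof. intro he; destruct (is_derive_arc e1 e2 phi he) as [v [hv _]];
  eapply curve_continuous, hv. Qed.

Lemma sphere_om_lat (p : pt) :
  sphere eps tau Rad p -> om p ^ 2 + a ^ 2 * lat p ^ 2 = equator_om ^ 2.
Proof.
intro hp; apply sphere_iff in hp; try easy; unfold rad2 in hp.
rewrite equator_om_sqr, om_sqr, <- hp; ring.
Qed.

(** A point is recovered from [r], [k] and the unit number [e] by solving
    [z (w + i a k) = omega Rad * r * e] for [z]; the modulus of [w + i a k] is
    [omega Rad]. *)
Lemma eq_arc (e1 e2 phi : R) (p : pt) :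
  sphere eps tau Rad p -> normz p = Rad * sin phi -> lat p = Rad * cos phi ->
  cx p * om p - a * lat p * cy p = equator_om * normz p * e1 ->
  cy p * om p + a * lat p * cx p = equator_om * normz p * e2 ->
  p = arc e1 e2 phi.
Proof.
intros hp hr hk h1 h2.
assert (hw : arc_om phi = om p).
{ unfold arc_om, om; rewrite <- hr, normz_sqr; easy. }
pose proof (sphere_om_lat p hp) as hs; pose proof equator_om_pos as hv.
rewrite <- (from_round_lat p) at 1.
assert (ex : cx p = arc_x e1 e2 phi).
{ unfold arc_x; rewrite hw, <- hr, <- hk.
  apply Rmult_eq_reg_r with (equator_om ^ 2); [| nra].
  replace (normz p * (e1 * om p + e2 * (a * lat p)) / equator_om * equator_om ^ 2) with
    (equator_om * normz p * e1 * om p + equator_om * normz p * e2 * (a * lat p)) by (field; lra).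
  rewrite <- h1, <- h2, <- hs; ring. }
assert (ey : cy p = arc_y e1 e2 phi).
{ unfold arc_y; rewrite hw, <- hr, <- hk.
  apply Rmult_eq_reg_r with (equator_om ^ 2); [| nra].
  replace (normz p * (e2 * om p - e1 * (a * lat p)) / equator_om * equator_om ^ 2) with
    (equator_om * normz p * e2 * om p - equator_om * normz p * e1 * (a * lat p)) by (field; lra).
  rewrite <- h1, <- h2, <- hs; ring. }
unfold arc; now rewrite <- ex, <- ey, hk.
Qed.

Lemma arc_direction (e1 e2 phi : R) :
  e1 ^ 2 + e2 ^ 2 = 1 -> 0 < sin phi ->
  let p := arc e1 e2 phi in
  (cx p * om p - a * lat p * cy p) / normz p = equator_om * e1 /\
  (cy p * om p + a * lat p * cx p) / normz p = equator_om * e2.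
Proof.
intros he hs p.
assert (c1 : cx p = arc_x e1 e2 phi) by easy; assert (c2 : cy p = arc_y e1 e2 phi) by easy.
unfold p in *; rewrite om_arc, lat_arc, normz_arc, c1, c2 by (try easy; lra).
unfold arc_x, arc_y.
pose proof equator_om_sqr as h1; pose proof equator_om_pos as h2; pose proof (sin_sqr phi) as h4.
assert (h5 : arc_om phi ^ 2 = 1 + a ^ 2 * Rad ^ 2 - a ^ 2 * Rad ^ 2 * cos phi ^ 2)
  by (rewrite arc_om_sqr, Rpow_mult_distr, h4; ring).
split; field [h1 h5]; nonzero.
Qed.

Lemma arc_through (p : pt) :
  sphere_star eps tau Rad p ->
  exists e1 e2 phi, e1 ^ 2 + e2 ^ 2 = 1 /\ 0 < phi < PI /\ p = arc e1 e2 phi.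
Proof.
intro hp; apply sphere_star_iff in hp; try easy; destruct hp as [hp hr].
pose proof (sphere_om_lat p hp) as hs; pose proof equator_om_pos as hv.
assert (hR : normz p ^ 2 + lat p ^ 2 = Rad ^ 2)
  by (rewrite normz_sqr; now apply sphere_iff in hp).
assert (hlt : -1 < lat p / Rad < 1).
{ split; [apply Rmult_lt_reg_r with Rad | apply Rmult_lt_reg_r with Rad]; try easy;
    unfold Rdiv; rewrite Rmult_assoc, Rinv_l by lra; nra. }
exists ((cx p * om p - a * lat p * cy p) / (equator_om * normz p)),
  ((cy p * om p + a * lat p * cx p) / (equator_om * normz p)), (acos (lat p / Rad)).
split; [| split].
- transitivity ((cx p ^ 2 + cy p ^ 2) * (om p ^ 2 + a ^ 2 * lat p ^ 2)
    / (equator_om ^ 2 * normz p ^ 2)); [field; nonzero |].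
  rewrite hs, <- normz_sqr; field; nonzero.
- now apply acos_bound_lt.
- apply eq_arc; try easy.
  + rewrite sin_acos by lra.
    replace (1 - (lat p / Rad)²) with ((normz p / Rad) ^ 2).
    * rewrite sqrt_pow2; [field; lra |]; apply Rlt_le, Rdiv_lt_0_compat; lra.
    * unfold Rsqr; transitivity ((Rad ^ 2 - lat p ^ 2) / Rad ^ 2);
        [replace (Rad ^ 2 - lat p ^ 2) with (normz p ^ 2) by lra |]; field; lra.
  + rewrite cos_acos by lra; field; lra.
  + field; nonzero.
  + field; nonzero.
Qed.

Definition latitude_angle (phi0 u : R) : R := phi0 + u / (eps * Rad).

Definition meridian_curve (e1 e2 phi0 u : R) : pt := arc e1 e2 (latitude_angle phi0 u).

Definition start_time (phi0 : R) : R := - (phi0 * (eps * Rad)).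
Definition end_time (phi0 : R) : R := (PI - phi0) * (eps * Rad).

Lemma er_pos : 0 < eps * Rad.
Proof. now apply Rmult_lt_0_compat. Qed.

Lemma latitude_angle_start (phi0 : R) : latitude_angle phi0 (start_time phi0) = 0.
Proof. unfold latitude_angle, start_time; field; lra. Qed.

Lemma latitude_angle_end (phi0 : R) : latitude_angle phi0 (end_time phi0) = PI.
Proof. unfold latitude_angle, end_time; field; lra. Qed.

Lemma start_lt_end (phi0 : R) : start_time phi0 < end_time phi0.
Proof. pose proof PI_RGT_0; pose proof er_pos; unfold start_time, end_time; nra. Qed.

Lemma latitude_angle_lt (phi0 u v : R) : u < v <-> latitude_angle phi0 u < latitude_angle phi0 v.
Proof.
pose proof (Rinv_0_lt_compat _ er_pos) as h; unfold latitude_angle, Rdiv; split; intro; nra.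
Qed.

Lemma sin_latitude_angle_pos (phi0 u : R) :
  start_time phi0 < u < end_time phi0 -> 0 < sin (latitude_angle phi0 u).
Proof.
intros [h1 h2]; apply (latitude_angle_lt phi0) in h1, h2.
rewrite latitude_angle_start in h1; rewrite latitude_angle_end in h2; now apply sin_gt_0.
Qed.

Lemma is_derive_latitude_angle (phi0 u : R) :
  is_derive (latitude_angle phi0) u (/ (eps * Rad)).
Proof. unfold latitude_angle; auto_derive; [easy | field; lra]. Qed.

Lemma meridian_curve_continuous (e1 e2 phi0 u : R) :
  e1 ^ 2 + e2 ^ 2 = 1 -> continuous (meridian_curve e1 e2 phi0) u.
Proof.
intro he; apply (continuous_comp (latitude_angle phi0) (arc e1 e2)); [| now apply arc_continuous].
apply (ex_derive_continuous (latitude_angle phi0)); eexists; apply is_derive_latitude_angle.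
Qed.

Lemma meridian_curve_start (e1 e2 phi0 : R) :
  meridian_curve e1 e2 phi0 (start_time phi0) = north eps tau Rad.
Proof.
rewrite north_from_round by easy; unfold meridian_curve, arc, arc_x, arc_y.
rewrite latitude_angle_start, sin_0, cos_0; unfold Rdiv; f_equal; ring.
Qed.

Lemma meridian_curve_end (e1 e2 phi0 : R) :
  meridian_curve e1 e2 phi0 (end_time phi0) = south eps tau Rad.
Proof.
rewrite south_from_round by easy; unfold meridian_curve, arc, arc_x, arc_y.
rewrite latitude_angle_end, sin_PI, cos_PI; unfold Rdiv; f_equal; ring.
Qed.

Lemma meridian_curve_integral (e1 e2 phi0 : R) :
  e1 ^ 2 + e2 ^ 2 = 1 ->
  integral_curve (sphere_star eps tau Rad) MM (start_time phi0) (end_time phi0)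
    (meridian_curve e1 e2 phi0).
Proof.
intro he; split; [apply start_lt_end |]; intros u hu.
pose proof (sin_latitude_angle_pos phi0 u hu) as hs.
assert (hr : 0 < normz (meridian_curve e1 e2 phi0 u)).
{ unfold meridian_curve; rewrite normz_arc by (try easy; lra); nra. }
split.
- apply sphere_star_iff; try easy; split; [now apply arc_sphere | easy].
- rewrite meridian_field_eq by easy.
  destruct (is_derive_arc e1 e2 (latitude_angle phi0 u) he) as [v [hv ev]].
  specialize (ev hs).
  replace (meridian (meridian_curve e1 e2 phi0 u)) with (scal (/ (eps * Rad)) v : pt).
  + apply (is_derive_comp (arc e1 e2) (latitude_angle phi0)); [easy |].
    apply is_derive_latitude_angle.
  + rewrite ev; apply pt_eq; coords; unfold meridian_curve; field; lra.
Qed.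

(** The first two functions are the coordinates of [(normz, lat)] in a frame that turns with
    it; the last two are the real and imaginary parts of [z (w + i a k) / r]. *)
Lemma integral_curve_first_integrals (b1 b2 : Rbar) (c : R -> pt) (phi0 u v : R) :
  integral_curve (sphere_star eps tau Rad) MM b1 b2 c ->
  in_interval b1 b2 u -> in_interval b1 b2 v ->
  let phi := latitude_angle phi0 in
  let I f := f u (c u) = f v (c v) :> R in
  I (fun s p => normz p * cos (phi s) - lat p * sin (phi s)) /\
  I (fun s p => normz p * sin (phi s) + lat p * cos (phi s)) /\
  I (fun s p => (cx p * om p - a * lat p * cy p) / normz p) /\
  I (fun s p => (cy p * om p + a * lat p * cx p) / normz p).
Proof.
intros [_ hc] hu hv phi I; unfold I; clear I.
assert (D : forall s, in_interval b1 b2 s ->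
  let p := c s in let m := meridian p in
  sphere eps tau Rad p /\ 0 < normz p /\
  is_derive (fun s => cx (c s)) s (cx m) /\ is_derive (fun s => cy (c s)) s (cy m) /\
  is_derive (fun s => normz (c s)) s (lat p / (eps * Rad)) /\
  is_derive (fun s => lat (c s)) s (- (normz p / (eps * Rad))) /\
  is_derive (fun s => om (c s)) s (a ^ 2 * normz p * (lat p / (eps * Rad)) / om p)).
{ intros s hs p m; destruct (hc s hs) as [h1 h2]; apply sphere_star_iff in h1; try easy.
  destruct h1 as [h1 hr]; fold p in h1, hr, h2.
  rewrite meridian_field_eq in h2 by easy.
  pose proof (sphere_rad Rad p Rad_pos h1) as e.
  pose proof (proj1 (is_derive_coordinates _ _ _) h2) as [hx [hy _]].
  do 4 (split; [easy |]); rewrite <- e; split; [| split].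
  - rewrite <- dnormz_meridian by easy.
    now apply is_derive_normz.
  - rewrite <- dlat_meridian by easy; now apply is_derive_lat.
  - rewrite <- dnormz_meridian by easy.
    rewrite <- dom_dnormz by easy; now apply is_derive_om. }
repeat apply conj.
- apply (constant_on_interval b1 b2 (fun s => normz (c s) * cos (phi s) - lat (c s) * sin (phi s)));
    try easy; intros s hs.
  destruct (D s hs) as [_ [hr [_ [_ [dr [dk _]]]]]].
  pose proof (is_derive_latitude_angle phi0 s) as dphi; fold phi in dphi.
  set (r := fun s => normz (c s)) in *; set (k := fun s => lat (c s)) in *.
  change (is_derive (fun s => r s * cos (phi s) - k s * sin (phi s)) s 0).
  change (is_derive r s (k s / (eps * Rad))) in dr; change (is_derive k s (- (r s / (eps *
    Rad)))) in dk.
  auto_derive; [repeat split; eexists; eassumption |].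
  rewrite_derivatives; field; lra.
- apply (constant_on_interval b1 b2 (fun s => normz (c s) * sin (phi s) + lat (c s) * cos (phi s)));
    try easy; intros s hs.
  destruct (D s hs) as [_ [hr [_ [_ [dr [dk _]]]]]].
  pose proof (is_derive_latitude_angle phi0 s) as dphi; fold phi in dphi.
  set (r := fun s => normz (c s)) in *; set (k := fun s => lat (c s)) in *.
  change (is_derive (fun s => r s * sin (phi s) + k s * cos (phi s)) s 0).
  change (is_derive r s (k s / (eps * Rad))) in dr; change (is_derive k s (- (r s / (eps *
    Rad)))) in dk.
  auto_derive; [repeat split; eexists; eassumption |].
  rewrite_derivatives; field; lra.
- apply (constant_on_interval b1 b2 (fun s => (cx (c s) * om (c s) - a * lat (c s) * cy (c s)) /
    normz (c s)));
    try easy; intros s hs.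
  destruct (D s hs) as [hp [hr [dx [dy [dr [dk dw]]]]]].
  pose proof (om_pos (c s)) as hw.
  assert (hw2 : om (c s) ^ 2 = 1 + a ^ 2 * normz (c s) ^ 2) by (rewrite normz_sqr; apply om_sqr).
  unfold meridian in dx, dy; rewrite cx_mk in dx; rewrite cy_mk in dy.
  rewrite (sphere_rad Rad) in dx, dy by easy.
  set (x := fun s => cx (c s)) in *; set (y := fun s => cy (c s)) in *;
    set (w := fun s => om (c s)) in *.
  set (r := fun s => normz (c s)) in *; set (k := fun s => lat (c s)) in *.
  change (is_derive (fun s => (x s * w s - a * k s * y s) / r s) s 0).
  change (is_derive x s ((k s * w s * x s - a * r s ^ 2 * y s) / (eps * Rad * r s * w s))) in dx.
  change (is_derive y s ((k s * w s * y s + a * r s ^ 2 * x s) / (eps * Rad * r s * w s))) in dy.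
  change (is_derive w s (a ^ 2 * r s * (k s / (eps * Rad)) / w s)) in dw.
  change (is_derive r s (k s / (eps * Rad))) in dr; change (is_derive k s (- (r s / (eps *
    Rad)))) in dk.
  change (0 < r s) in hr; change (0 < w s) in hw; change (w s ^ 2 = 1 + a ^ 2 * r s ^ 2) in hw2.
  auto_derive; [repeat split; try (eexists; eassumption); lra |].
  rewrite_derivatives; field [hw2]; nonzero.
- apply (constant_on_interval b1 b2 (fun s => (cy (c s) * om (c s) + a * lat (c s) * cx (c s)) /
    normz (c s)));
    try easy; intros s hs.
  destruct (D s hs) as [hp [hr [dx [dy [dr [dk dw]]]]]].
  pose proof (om_pos (c s)) as hw.
  assert (hw2 : om (c s) ^ 2 = 1 + a ^ 2 * normz (c s) ^ 2) by (rewrite normz_sqr; apply om_sqr).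
  unfold meridian in dx, dy; rewrite cx_mk in dx; rewrite cy_mk in dy.
  rewrite (sphere_rad Rad) in dx, dy by easy.
  set (x := fun s => cx (c s)) in *; set (y := fun s => cy (c s)) in *;
    set (w := fun s => om (c s)) in *.
  set (r := fun s => normz (c s)) in *; set (k := fun s => lat (c s)) in *.
  change (is_derive (fun s => (y s * w s + a * k s * x s) / r s) s 0).
  change (is_derive x s ((k s * w s * x s - a * r s ^ 2 * y s) / (eps * Rad * r s * w s))) in dx.
  change (is_derive y s ((k s * w s * y s + a * r s ^ 2 * x s) / (eps * Rad * r s * w s))) in dy.
  change (is_derive w s (a ^ 2 * r s * (k s / (eps * Rad)) / w s)) in dw.
  change (is_derive r s (k s / (eps * Rad))) in dr; change (is_derive k s (- (r s / (eps *
    Rad)))) in dk.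
  change (0 < r s) in hr; change (0 < w s) in hw; change (w s ^ 2 = 1 + a ^ 2 * r s ^ 2) in hw2.
  auto_derive; [repeat split; try (eexists; eassumption); lra |].
  rewrite_derivatives; field [hw2]; nonzero.
Qed.

(** The first integrals replace a uniqueness theorem for differential equations.  The bounds
    on the interval hold because [normz] vanishes on the explicit curve at both ends. *)
Lemma integral_curve_is_meridian (b1 b2 : Rbar) (c : R -> pt) :
  integral_curve (sphere_star eps tau Rad) MM b1 b2 c ->
  exists e1 e2 phi0, e1 ^ 2 + e2 ^ 2 = 1 /\
    (forall u, in_interval b1 b2 u -> c u = meridian_curve e1 e2 phi0 u) /\
    Rbar_le (start_time phi0) b1 /\ Rbar_le b2 (end_time phi0).
Proof.
intro hc; destruct (interval_inhabited b1 b2 (proj1 hc)) as [v hv].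
destruct (arc_through (c v)) as [e1 [e2 [phi1 [he [hphi ev]]]]]; [now apply hc |].
(* The explicit curve is shifted in time so that it meets [c] at the time [v]. *)
set (phi0 := phi1 - v / (eps * Rad)); exists e1, e2, phi0.
assert (ephi : latitude_angle phi0 v = phi1) by (unfold latitude_angle, phi0; ring).
assert (hs : 0 < sin phi1) by (apply sin_gt_0; lra).
pose proof equator_om_pos as hW.
assert (key : forall u, in_interval b1 b2 u ->
  0 < normz (c u) /\ normz (c u) = Rad * sin (latitude_angle phi0 u) /\
  c u = meridian_curve e1 e2 phi0 u).
{ intros u hu.
  pose proof (proj1 (proj2 hc u hu)) as hp; apply sphere_star_iff in hp; try easy.
  destruct hp as [hp hr].
  destruct (integral_curve_first_integrals b1 b2 c phi0 u v hc hu hv) as [i1 [i2 [i3 i4]]].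
  destruct (arc_direction e1 e2 phi1 he hs) as [j1 j2].
  rewrite ephi, ev in i1, i2; rewrite ev, j1 in i3; rewrite ev, j2 in i4.
  rewrite lat_arc, normz_arc in i1, i2 by (try easy; lra).
  set (f := latitude_angle phi0 u) in *.
  pose proof (sin_sqr f) as q; pose proof (sin_sqr phi1) as q1.
  assert (k1 : normz (c u) = Rad * sin f).
  { transitivity ((normz (c u) * cos f - lat (c u) * sin f) * cos f
      + (normz (c u) * sin f + lat (c u) * cos f) * sin f); [ring [q] |].
    rewrite i1, i2; ring [q1]. }
  assert (k2 : lat (c u) = Rad * cos f).
  { transitivity ((normz (c u) * sin f + lat (c u) * cos f) * cos f
      - (normz (c u) * cos f - lat (c u) * sin f) * sin f); [ring [q] |].
    rewrite i1, i2; ring [q1]. }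
  split; [easy | split; [easy |]].
  apply eq_arc; try easy.
  - apply (f_equal (fun z => z * normz (c u))) in i3.
    replace (equator_om * normz (c u) * e1) with (equator_om * e1 * normz (c u)) by ring.
    rewrite <- i3; field; lra.
  - apply (f_equal (fun z => z * normz (c u))) in i4.
    replace (equator_om * normz (c u) * e2) with (equator_om * e2 * normz (c u)) by ring.
    rewrite <- i4; field; lra. }
assert (v1 : start_time phi0 < v).
{ apply (latitude_angle_lt phi0); rewrite latitude_angle_start, ephi; lra. }
assert (v2 : v < end_time phi0).
{ apply (latitude_angle_lt phi0); rewrite latitude_angle_end, ephi; lra. }
split; [easy | split; [intros u hu; now apply key | split]].
- apply Rbar_not_lt_le; intro h.
  destruct (key (start_time phi0)) as [k1 [k2 _]].
  + split; [easy | apply Rbar_lt_trans with v; [easy | apply hv]].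
  + rewrite k2, latitude_angle_start, sin_0 in k1; lra.
- apply Rbar_not_lt_le; intro h.
  destruct (key (end_time phi0)) as [k1 [k2 _]].
  + split; [apply Rbar_lt_trans with v; [apply hv | easy] | easy].
  + rewrite k2, latitude_angle_end, sin_PI in k1; lra.
Qed.

(** Every integral curve is defined on an interval of length at most [PI * eps * Rad], and
    this one has exactly that length. *)
Lemma meridian_curve_maximal (e1 e2 phi0 : R) :
  e1 ^ 2 + e2 ^ 2 = 1 ->
  maximal_integral_curve (sphere_star eps tau Rad) MM (start_time phi0) (end_time phi0)
    (meridian_curve e1 e2 phi0).
Proof.
intro he; split; [now apply meridian_curve_integral |].
intros b1 b2 c hc h1 h2 _.
destruct (integral_curve_is_meridian b1 b2 c hc) as [_ [_ [phi1 [_ [_ [h3 h4]]]]]].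
pose proof (Rbar_le_trans _ _ _ h3 h1) as h5; pose proof (Rbar_le_trans _ _ _ h2 h4) as h6.
simpl in h5, h6; unfold start_time, end_time in h5, h6.
pose proof er_pos as hp.
assert (e : phi1 = phi0) by nra.
subst phi1; split; now apply Rbar_le_antisym.
Qed.

Lemma maximal_integral_curve_ends (b1 b2 : Rbar) (c : R -> pt) :
  maximal_integral_curve (sphere_star eps tau Rad) MM b1 b2 c ->
  exists t1 t2 : R, b1 = Finite t1 /\ b2 = Finite t2 /\
    filterlim c (at_right t1) (locally (north eps tau Rad)) /\
    filterlim c (at_left t2) (locally (south eps tau Rad)).
Proof.
intros [hc hmax].
destruct (integral_curve_is_meridian b1 b2 c hc) as [e1 [e2 [phi0 [he [ec [h1 h2]]]]]].
destruct (hmax (start_time phi0) (end_time phi0) (meridian_curve e1 e2 phi0)) as [E1 E2];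
  try easy.
- now apply meridian_curve_integral.
- intros u hu; symmetry; now apply ec.
- exists (start_time phi0), (end_time phi0); split; [easy | split; [easy |]].
  pose proof (start_lt_end phi0) as hlt.
  rewrite <- (meridian_curve_start e1 e2 phi0), <- (meridian_curve_end e1 e2 phi0).
  split; apply filterlim_ext_loc with (meridian_curve e1 e2 phi0).
  + exists (mkposreal _ (proj1 (Rminus_lt_0 _ _) hlt)); intros u hu hpos.
    change (Rabs (u - start_time phi0) < end_time phi0 - start_time phi0) in hu.
    symmetry; apply ec; rewrite <- E1, <- E2; split; [easy |].
    apply Rabs_def2 in hu; simpl; lra.
  + apply filterlim_filter_le_1 with (2 := meridian_curve_continuous e1 e2 phi0 _ he).
    apply filter_le_within.
  + exists (mkposreal _ (proj1 (Rminus_lt_0 _ _) hlt)); intros u hu hneg.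
    change (Rabs (u - end_time phi0) < end_time phi0 - start_time phi0) in hu.
    symmetry; apply ec; rewrite <- E1, <- E2; split; [| easy].
    apply Rabs_def2 in hu; simpl; lra.
  + apply filterlim_filter_le_1 with (2 := meridian_curve_continuous e1 e2 phi0 _ he).
    apply filter_le_within.
Qed.

Lemma maximal_integral_curve_exists (p : pt) :
  sphere_star eps tau Rad p ->
  exists (b1 b2 : Rbar) (c : R -> pt),
    in_interval b1 b2 0 /\ c 0 = p /\
    maximal_integral_curve (sphere_star eps tau Rad) MM b1 b2 c.
Proof.
intro hp; destruct (arc_through p hp) as [e1 [e2 [phi [he [hphi ->]]]]].
assert (e0 : latitude_angle phi 0 = phi) by (unfold latitude_angle; field; lra).
exists (start_time phi), (end_time phi), (meridian_curve e1 e2 phi).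
split; [| split].
- split; apply (latitude_angle_lt phi); rewrite e0, ?latitude_angle_start, ?latitude_angle_end; lra.
- unfold meridian_curve; now rewrite e0.
- now apply meridian_curve_maximal.
Qed.

(** The acceleration of an integral curve is [nabla_meridian_meridian], a multiple of the
    normal. *)
Lemma integral_curve_geodesic (b1 b2 : Rbar) (c : R -> pt) :
  integral_curve (sphere_star eps tau Rad) MM b1 b2 c ->
  sphere_geodesic eps tau NN Rad b1 b2 c.
Proof.
intros [_ hc].
exists (fun u => meridian (c u)), (fun u => dmeridian (c u) (meridian (c u))).
intros u hu; destruct (hc u hu) as [h1 h2]; apply sphere_star_iff in h1; try easy.
destruct h1 as [h1 hr].
rewrite meridian_field_eq in h2 by easy.
split; [easy | split; [easy | split]].
- now apply is_derive_meridian.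
- rewrite <- field_deriv_meridian by easy.
  change (tangential eps tau NN (c u) (nabla eps tau meridian meridian (c u)) = zero).
  rewrite nabla_meridian_meridian by easy.
  now apply tangential_normal, rad2_normz.
Qed.

End Geometry.

Theorem theorem4p3
  (eps tau : R) (eps_pos : 0 < eps) (tau_neq0 : tau <> 0)
  (NN MM : pt -> pt)
  (NN_normal : is_normal_field eps tau NN)
  (MM_meridian : is_meridian_field eps tau NN MM)
  (Rad H : R) (Rad_pos : 0 < Rad) (H_def : H = 1 / (eps * Rad)) :
  (forall p, sphere eps tau Rad p -> mean_curvature_at eps tau NN Rad p H) /\
  smooth_field_on (fun p => 0 < normz p) MM /\
  (exists W : pt -> pt,
     smooth_field_on (sphere eps tau Rad) W /\
     (forall p, sphere_star eps tau Rad p -> nabla eps tau MM MM p = W p) /\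
     (forall p, sphere eps tau Rad p ->
        W p = scal (- (H / omega eps tau (normz p) ^ 2)) (NN p))) /\
  (forall p, sphere_star eps tau Rad p ->
     nabla_leaf eps tau NN MM MM p = zero) /\
  (forall p, sphere_star eps tau Rad p ->
     exists (a b : Rbar) (c : R -> pt),
       in_interval a b 0 /\ c 0 = p /\
       maximal_integral_curve (sphere_star eps tau Rad) MM a b c) /\
  (forall (a b : Rbar) (c : R -> pt),
     integral_curve (sphere_star eps tau Rad) MM a b c ->
     sphere_geodesic eps tau NN Rad a b c) /\
  (forall (a b : Rbar) (c : R -> pt),
     maximal_integral_curve (sphere_star eps tau Rad) MM a b c ->
     exists a0 b0 : R,
       a = Finite a0 /\ b = Finite b0 /\
       filterlim c (at_right a0) (locally (north eps tau Rad)) /\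
       filterlim c (at_left b0) (locally (south eps tau Rad))).
Proof.
rewrite H_def.
split; [| split; [| split; [| split; [| split; [| split]]]]].
- intros p hp; now apply mean_curvature.
- intros p hp; exists (fun q => 0 < normz q), (meridian eps tau).
  split; [apply open_normz | split; [easy | split]].
  + apply smooth_field_meridian; [easy | easy | apply open_normz | easy].
  + intros q hq _; symmetry; now apply meridian_field_eq with NN.
- exists (fun p => scal (- (1 / (eps * Rad) / omega eps tau (normz p) ^ 2)) (NN p)).
  split; [| split; [| easy]].
  + intros p hp.
    exists (fun q => 0 < rad2 eps tau q),
      (fun q => scal (- (1 / (eps * Rad) / omega eps tau (normz q) ^ 2)) (normal eps tau q)).
    split; [now apply open_rad2 | split; [now apply rad2_sphere with Rad | split]].
    * apply smooth_field_scaled_normal; try easy; now apply open_rad2.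
    * intros q _ hq; now rewrite (normal_field_eq eps tau eps_pos tau_neq0 NN _ NN_normal).
  + intros p hp; apply sphere_star_iff in hp; try easy; destruct hp as [hp hr].
    rewrite (nabla_MM_MM eps tau eps_pos tau_neq0 NN NN_normal MM MM_meridian) by easy.
    rewrite (normal_field_eq eps tau eps_pos tau_neq0 NN _ NN_normal) by (now apply rad2_sphere
      with Rad).
    rewrite omega_normz, (sphere_rad eps tau eps_pos tau_neq0 Rad) by easy.
    f_equal; pose proof (om_pos eps tau p); field; split; lra.
- intros p hp; apply sphere_star_iff in hp; try easy; destruct hp as [_ hr].
  unfold nabla_leaf; rewrite (nabla_MM_MM eps tau eps_pos tau_neq0 NN NN_normal MM MM_meridian)
    by easy.
  apply tangential_normal; try easy; now apply rad2_normz.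
- intros p hp; eapply maximal_integral_curve_exists; eassumption.
- intros b1 b2 c hc; eapply integral_curve_geodesic; eassumption.
- intros b1 b2 c hc; eapply maximal_integral_curve_ends; eassumption.
Qed.
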